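(* Let $K\in(0,1)$, let $(W_\theta,\ \theta\ge 0)$ be a standard Brownian motion, and define the process $X^K=(X^K_t,\ t\ge 0)$ by $$X^K_t=\int_0^\infty (1-e^{-\theta t})\,\theta^{-\frac{1+K}{2}}\,dW_\theta .$$ Then $X^K$ has a version whose trajectories are infinitely differentiable on $(0,\infty)$ and absolutely continuous on $[0,\infty)$.
   Context: The integral defining $X^K_t$ is, for each fixed $t\ge0$, a Wiener integral of a deterministic square-integrable function with respect to $W$. A version of $X^K$ is a process $\widetilde X$ on the same probability space with $P(\widetilde X_t=X^K_t)=1$ for every $t\ge 0$. Absolute continuity on $[0,\infty)$ is understood in the usual sense for functions on a half-line: the function is absolutely continuous on every compact interval $[0,T]$, i.e. it is the integral of a locally integrable function on $[0,\infty)$. *)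

(* Defs.v *)
From HB Require Import structures.
From mathcomp Require Import all_boot all_order all_algebra.
From mathcomp Require Import all_classical all_reals all_analysis.

Set Implicit Arguments.
Unset Strict Implicit.
Unset Printing Implicit Defensive.

Import Order.TTheory GRing.Theory Num.Theory.
Import numFieldNormedType.Exports.

Local Open Scope classical_set_scope.
Local Open Scope ring_scope.

(* Processes indexed by [0, +oo[ are represented by families indexed by R of   *)
(* which only the members with nonnegative index are ever constrained.         *)

Definition mutually_independent (d : measure_display) (T : measurableType d)
    (R : realType) (P : probability T R) (n : nat) (Y : 'I_n -> T -> R) : Prop :=
  forall (J : {set 'I_n}) (B : 'I_n -> set R),
    (forall i, measurable (B i)) ->
    P (\bigcap_(i in [set` J]) (Y i @^-1` B i)) =
      (\prod_(i in J) P (Y i @^-1` B i))%E.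

(* The second parameter of [normal_prob] is the standard deviation. *)
Record standard_brownian_motion (d : measure_display) (T : measurableType d)
    (R : realType) (P : probability T R) (W : R -> {RV P >-> R}) : Prop := {
  brownian_start : {ae P, forall w, W 0 w = 0} ;
  brownian_independent_increments : forall (n : nat) (t : nat -> R),
    0 <= t 0%N -> (forall i, (i < n)%N -> t i <= t i.+1) ->
    mutually_independent P (fun (i : 'I_n) w => W (t i.+1) w - W (t i) w) ;
  brownian_gaussian_increments : forall s t : R, 0 <= s -> s < t ->
    forall B : set R, measurable B ->
    P ((W t \- W s) @^-1` B) = normal_prob 0 (Num.sqrt (t - s)) B ;
  brownian_continuous_paths :
    {ae P, forall w, {within `[0, +oo[, continuous (fun t : R => W t w)}}
}.

(* A list of triples (c, (a, b)) encodes the step function                     *)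
(* \sum c * \1_(]a, b]), whose integral against dW is \sum c * (W_b - W_a).    *)
Definition step_valid (R : realType) (s : seq (R * (R * R))) : bool :=
  all (fun p => (0 <= p.2.1) && (p.2.1 <= p.2.2)) s.

Definition step_fun (R : realType) (s : seq (R * (R * R))) (x : R) : R :=
  \sum_(p <- s) p.1 * \1_(`]p.2.1, p.2.2] : set R) x.

Definition step_wiener (d : measure_display) (T : measurableType d)
    (R : realType) (P : probability T R) (W : R -> {RV P >-> R})
    (s : seq (R * (R * R))) (w : T) : R :=
  \sum_(p <- s) p.1 * (W p.2.2 w - W p.2.1 w).

(* Y is a representative of the integral of f over [0, +oo[ against dW: the    *)
(* Wiener integral is the L^2-continuous extension of [step_wiener] from step  *)
(* functions to L^2([0, +oo[), so it is determined up to almost sure equality. *)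
Definition is_wiener_integral (d : measure_display) (T : measurableType d)
    (R : realType) (P : probability T R) (W : R -> {RV P >-> R})
    (f : R -> R) (Y : {RV P >-> R}) : Prop :=
  [/\ measurable_fun (`[0, +oo[ : set R) f,
      lebesgue_measure.-integrable (`[0, +oo[ : set R) (fun x => (f x ^+ 2)%:E) &
      exists s : nat -> seq (R * (R * R)),
        [/\ forall n, step_valid (s n),
            (\int[lebesgue_measure]_(x in (`[0%R, +oo[ : set R))
               ((f x - step_fun (s n) x) ^+ 2)%:E)%E @[n --> \oo] --> 0%E &
            ('E_P[(fun w => (Y w - step_wiener W (s n) w) ^+ 2)%R])%E
               @[n --> \oo] --> 0%E]].

Definition is_version (d : measure_display) (T : measurableType d)
    (R : realType) (P : probability T R) (X X' : R -> {RV P >-> R}) : Prop :=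
  forall t : R, 0 <= t -> P [set w | X' t w = X t w] = 1%E.

Definition smooth_on_pos (R : realType) (f : R -> R) : Prop :=
  forall (n : nat) (x : R), 0 < x -> derivable (derive1n n f) x 1.

Definition absolutely_continuous_on (R : realType) (a b : R) (f : R -> R) : Prop :=
  forall e : R, 0 < e -> exists2 delta : R, 0 < delta &
    forall (n : nat) (u v : nat -> R),
      (forall i, (i < n)%N -> a <= u i /\ u i <= v i /\ v i <= b) ->
      trivIset `I_n (fun i => `]u i, v i[%classic) ->
      \sum_(i < n) (v i - u i) < delta ->
      \sum_(i < n) `|f (v i) - f (u i)| < e.

Definition absolutely_continuous_half_line (R : realType) (f : R -> R) : Prop :=
  forall b : R, 0 <= b -> absolutely_continuous_on 0 b f.

(* Main.v *)
(* With alpha = (1+K)/2, integration by parts turns the Wiener integral into a  *)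

(* Regularity is a deterministic matter. For a function H on the half-line with H(x) min(1, x)
   integrable, [potential H a] is t -> \int H(x) kappa(x t) dx. It is a combination of a Laplace
   transform of H and t times its derivative, which gives [potential_smooth]; the comparison of
   increments of kappa with those of e^(-y/2) gives [potential_absolutely_continuous]. The version
   is the potential of H(x) = x^(-alpha-1) V(w, x), where V is a modification of W that is jointly
   measurable and integrable enough for every w ([brownian_modification]). The condition 1/2 < alpha
   < 1 makes x^(-alpha-1) min(1, x) sqrt x integrable both at 0 and at infinity
   ([integrable_power_weight]).

   For the identification, integration by parts is never done on paths. Its weak form
   [Rintegral_tail] says that the integral of f over ]0, c] equals \int g(x) min(x, c) dx when f is
   the tail integral of g. Up to a common factor the two sides are the covariances with W_c of the
   Wiener integral of f and of \int g(x) V_x dx. Fubini ([Rintegral_averaged_mul]) and the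
   covariance of W ([brownian_covariance]) make this precise, and [wiener_integral_averaged]
   concludes that the two variables agree almost surely. *)
(* pathwise Lebesgue integral:                                                 *)
(*   X_t = \int_0^oo g_t(x) W_x dx,  g_t(x) = - d/dx ((1 - e^(-xt)) x^(-alpha)) *)
(*       = x^(-alpha-1) kappa(x t),  kappa(y) = alpha (1 - e^(-y)) - y e^(-y).  *)
(* Since E |W_x| is of order sqrt x, the integral converges absolutely almost  *)
(* surely, for all t simultaneously.  Smoothness on ]0, +oo[ follows by        *)
(* differentiating under the integral sign.  Absolute continuity follows from  *)
(* |kappa(y') - kappa(y)| <= C (e^(-y/2) - e^(-y'/2)) for y <= y': over        *)
(* disjoint intervals of total length delta these increments, taken at x t,    *)
(* sum to at most C min(1, x delta), whose integral against                    *)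
(* x^(-alpha-1) |W_x| tends to 0 with delta.  The pathwise integral agrees     *)
(* with the Wiener integral because their difference is orthogonal in L^2(P)   *)
(* to every W_c, hence, by Fubini, to itself.                                  *)
Require Import Defs.
From HB Require Import structures.
From mathcomp Require Import all_boot all_order all_algebra.
From mathcomp Require Import all_classical all_reals all_analysis.
From mathcomp Require Import measurable_realfun ring lra.
Import Order.TTheory GRing.Theory Num.Theory.
Import numFieldNormedType.Exports.
Local Open Scope classical_set_scope.
Local Open Scope ring_scope.

Set Implicit Arguments.
Unset Strict Implicit.
Unset Printing Implicit Defensive.

(** * Square-integrable functions *)

Section square_integrable.
Context d (T : measurableType d) (R : realType).
Variable mu : {measure set T -> \bar R}.
Implicit Types f g : T -> R.

Lemma Lfun2P f : measurable_fun setT f ->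
  (\int[mu]_x (f x ^+ 2)%:E < +oo)%E -> f \in Lfun mu 2%:E.
Proof.
move=> mf f2; rewrite inE/=; apply/andP; split; rewrite inE//=.
rewrite /finite_norm unlock /Lnorm; apply: poweR_lty.
by under eq_integral do rewrite /= powR_mulrn// -normrX ger0_norm ?sqr_ge0//.
Qed.

Lemma Lfun_measurable f p : f \in Lfun mu p -> measurable_fun setT f.
Proof. by move/sub_Lfun_mfun; rewrite inE. Qed.

Lemma integrable_mul_Lfun2 f g : f \in Lfun mu 2%:E -> g \in Lfun mu 2%:E ->
  mu.-integrable setT (fun x => (f x * g x)%:E).
Proof. by move=> lf lg; apply/Lfun1_integrable; exact: Lfun2_mul_Lfun1. Qed.

Lemma Lfun2D f g : f \in Lfun mu 2%:E -> g \in Lfun mu 2%:E ->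
  (fun x => f x + g x) \in Lfun mu 2%:E.
Proof.
move=> lf lg; rewrite (_ : (fun _ => _) = f + g)//.
by have [_ +] := Lfun_addr_closed mu (@lee1n R 2); apply.
Qed.

Lemma Lfun2Z f (k : R) : f \in Lfun mu 2%:E -> (fun x => k * f x) \in Lfun mu 2%:E.
Proof.
move=> lf; rewrite (_ : (fun _ => _) = k \o* f); first by apply: Lfun_scale => //; rewrite ler1n.
by apply/funext => x /=; rewrite mulrC.
Qed.

Lemma Lfun2B f g : f \in Lfun mu 2%:E -> g \in Lfun mu 2%:E ->
  (fun x => f x - g x) \in Lfun mu 2%:E.
Proof.
move=> lf lg; under eq_fun do rewrite -mulN1r.
by apply: Lfun2D => //; exact: Lfun2Z.
Qed.

Lemma Rintegral_mulDl f g h : f \in Lfun mu 2%:E -> g \in Lfun mu 2%:E ->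
  h \in Lfun mu 2%:E ->
  \int[mu]_x ((f x + g x) * h x) = \int[mu]_x (f x * h x) + \int[mu]_x (g x * h x).
Proof.
move=> lf lg lh; under eq_Rintegral do rewrite mulrDl.
by rewrite RintegralD//; exact: integrable_mul_Lfun2.
Qed.

Lemma Rintegral_mulBl f g h : f \in Lfun mu 2%:E -> g \in Lfun mu 2%:E ->
  h \in Lfun mu 2%:E ->
  \int[mu]_x ((f x - g x) * h x) = \int[mu]_x (f x * h x) - \int[mu]_x (g x * h x).
Proof.
move=> lf lg lh; under eq_Rintegral do rewrite mulrBl.
by rewrite RintegralB//; exact: integrable_mul_Lfun2.
Qed.

Lemma Rintegral_mulZl f h (k : R) : f \in Lfun mu 2%:E -> h \in Lfun mu 2%:E ->
  \int[mu]_x (k * f x * h x) = k * \int[mu]_x (f x * h x).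
Proof.
move=> lf lh; under eq_Rintegral do rewrite -mulrA.
by rewrite RintegralZl//; exact: integrable_mul_Lfun2.
Qed.

Lemma fin_num_integral_sqr f : f \in Lfun mu 2%:E ->
  (\int[mu]_x (f x ^+ 2)%:E)%E \is a fin_num.
Proof. by move=> /Lfun2_integrable_sqr/integrable_fin_num-> //. Qed.

(** Integrated form of 2 |f g| <= f^2 / e + e g^2. Tuning the free weight e gives what
    Cauchy-Schwarz would. *)
Lemma normr_Rintegral_mul_le f g (e : R) : 0 < e ->
  f \in Lfun mu 2%:E -> g \in Lfun mu 2%:E ->
  `|\int[mu]_x (f x * g x)| <=
    (\int[mu]_x (f x ^+ 2) / e + e * \int[mu]_x (g x ^+ 2)) / 2.
Proof.
move=> e0 lf lg; apply: le_trans (le_normr_Rintegral _ (integrable_mul_Lfun2 lf lg)) _ => //.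
have if2 := Lfun2_integrable_sqr lf; have ig2 := Lfun2_integrable_sqr lg.
have if3 : mu.-integrable setT (EFin \o (fun x => f x ^+ 2 / e)).
  exact: (integrableZr measurableT _ if2).
have ig3 : mu.-integrable setT (EFin \o (fun x => e * g x ^+ 2)).
  exact: (integrableZl measurableT _ ig2).
have ih : mu.-integrable setT (EFin \o (fun x => f x ^+ 2 / e + e * g x ^+ 2)).
  exact: (integrableD measurableT if3 ig3).
rewrite -RintegralZl// -RintegralZr// -RintegralD// -RintegralZr//.
apply: le_Rintegral => //.
- exact: (integrable_norm (integrable_mul_Lfun2 lf lg)).
- exact: (integrableZr measurableT _ ih).
move=> x _; rewrite ler_pdivlMr// normrM -[f x ^+ 2]real_normK ?num_real//.
rewrite -[g x ^+ 2]real_normK ?num_real//; set a := `|f x|; set b := `|g x|.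
rewrite -subr_ge0 (_ : _ - _ = (a - e * b) ^+ 2 / e).
  by rewrite divr_ge0 ?sqr_ge0// ltW.
by field; rewrite gt_eqF.
Qed.

Lemma cvg_Rintegral_mul f g (u : nat -> T -> R) :
  f \in Lfun mu 2%:E -> g \in Lfun mu 2%:E -> (forall n, u n \in Lfun mu 2%:E) ->
  (\int[mu]_x ((f x - u n x) ^+ 2)%:E)%E @[n --> \oo] --> 0%E ->
  \int[mu]_x (u n x * g x) @[n --> \oo] --> \int[mu]_x (f x * g x).
Proof.
move=> lf lg lu /fine_cvg; rewrite /comp/= => cu; apply/cvgrPdist_le => /= e e0.
pose B := \int[mu]_x (g x ^+ 2); have B0 : 0 <= B by apply: Rintegral_ge0 => x _; exact: sqr_ge0.
(* With this weight r B <= e; the other term is at most e once the squared distance is below e r.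
   The summand 1 covers B = 0. *)
pose r := e / (B + 1); have r0 : 0 < r by rewrite divr_gt0// ltr_wpDl.
have er0 : 0 < e * r by rewrite mulr_gt0.
near=> n.
rewrite -Rintegral_mulBl//.
apply: le_trans (normr_Rintegral_mul_le r0 (Lfun2B lf (lu n)) lg) _.
have rB : r * B <= e.
  by rewrite /r mulrAC ler_pdivrMr ?ltr_wpDl// ler_wpM2l ?(ltW e0)// lerDl.
have : \int[mu]_x ((f x - u n x) ^+ 2) / r <= e.
  rewrite ler_pdivrMr//; apply: le_trans (ler_norm _) _; rewrite -[X in `|X|]subr0 distrC.
  by near: n; move/cvgrPdist_le : cu => /(_ _ er0).
rewrite -/B; lra.
Unshelve. all: by end_near. Qed.

Lemma ae_eq_Rintegral_sqr_eq0 f : f \in Lfun mu 2%:E ->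
  \int[mu]_x (f x * f x) = 0 -> {ae mu, forall x, f x = 0}.
Proof.
move=> lf f0; have mf := Lfun_measurable lf.
have : (\int[mu]_x `|(f x ^+ 2)%:E| = 0)%E.
  under eq_integral do rewrite gee0_abs ?lee_fin ?sqr_ge0//.
  rewrite -[LHS]fineK ?fin_num_integral_sqr//.
  transitivity (\int[mu]_x (f x * f x))%:E; last by rewrite f0.
  by congr EFin; apply: eq_Rintegral => x _; rewrite expr2.
move=> /ae_eq_integral_abs; case=> //.
  by apply/measurable_EFinP; exact: measurable_funX.
move=> N hN; exists N; case: hN => mN N0 hN; split => // x /= fx.
apply: hN => /= h; apply: fx; have := h I; rewrite /cst => -[] /eqP.
by rewrite sqrf_eq0 => /eqP.
Qed.

End square_integrable.

Local Notation mu := lebesgue_measure.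

(** * Covariance of Brownian motion *)

(** The Radon-Nikodym derivative of the normal law is almost everywhere the explicit density, since
    both have the same integral over every measurable set. *)
Lemma ge0_integral_normal_prob (R : realType) (m s : R) (f : R -> \bar R) :
  measurable_fun setT f -> (forall x, (0 <= f x)%E) ->
  (\int[normal_prob m s]_x f x = \int[mu]_x (f x * (normal_pdf m s x)%:E))%E.
Proof.
move=> mf f0.
rewrite -(Radon_Nikodym_SigmaFinite.change_of_variables (normal_prob_dominates m s))//.
apply: ae_eq_integral => //.
- apply: emeasurable_funM => //; apply: measurable_int.
  exact: Radon_Nikodym_SigmaFinite.f_integrable (normal_prob_dominates m s).
- apply: emeasurable_funM => //; apply/measurable_EFinP; exact: measurable_normal_pdf.
- apply: ae_eqe_mul2l; apply: integral_ae_eq => //.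
  + exact: Radon_Nikodym_SigmaFinite.f_integrable (normal_prob_dominates m s).
  + by apply/measurable_EFinP; exact: measurable_normal_pdf.
  + move=> E _ mE.
    by rewrite -(Radon_Nikodym_SigmaFinite.f_integral (normal_prob_dominates m s)).
Qed.

(** Passing from standard deviation 1 to 2 frees a factor e^(3 x^2 / 8), which absorbs x^2 because 1
    + y <= e^y. Hence the second moment is finite without being computed. *)
Lemma sqr_normal_pdf_le (R : realType) : exists C : R, 0 <= C /\
  forall x, x ^+ 2 * normal_pdf 0 1 x <= C * normal_pdf 0 2 x.
Proof.
have p1 := @normal_peak_gt0 R 1 (oner_neq0 _).
have p2 := @normal_peak_gt0 R 2 (lt0r_neq0 (ltr0n R 2)).
exists (8 / 3 * normal_peak 1 / normal_peak 2); split.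
  by rewrite divr_ge0 ?mulr_ge0 ?(ltW p1) ?(ltW p2)// divr_ge0.
move=> x; rewrite !normal_pdfE ?oner_neq0// /normal_fun subr0.
rewrite [leRHS](_ : _ = normal_peak 1 * (8 / 3 * expR (- x ^+ 2 / (2 ^+ 2 *+ 2)))); last first.
  by field; rewrite gt_eqF.
rewrite mulrCA ler_wpM2l ?(ltW p1)//.
have -> : - x ^+ 2 / (1 ^+ 2 *+ 2) = - (3 / 8 * x ^+ 2) + - x ^+ 2 / (2 ^+ 2 *+ 2).
  by rewrite expr1n; field.
rewrite expRD mulrA ler_wpM2r ?expR_ge0// expRN ler_pdivrMr ?expR_gt0//.
have := expR_ge1Dx (3 / 8 * x ^+ 2); lra.
Qed.

(* Only the scaling in s matters below, so v is not evaluated to 1. *)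
Lemma normal_second_moment (R : realType) : exists v : R, 0 <= v /\
  forall s : R, 0 < s ->
  (\int[normal_prob 0 s]_x (x ^+ 2)%:E = (v * s ^+ 2)%:E)%E.
Proof.
have msq : measurable_fun setT (fun x : R => (x ^+ 2)%:E).
  by apply/measurable_EFinP; exact: measurable_funX.
have sq0 (x : R) : (0 <= (x ^+ 2)%:E)%E by rewrite lee_fin sqr_ge0.
have mp (s : R) : measurable_fun setT (fun x : R => x ^+ 2 * normal_pdf 0 s x).
  by apply: measurable_funM; [exact: measurable_funX|exact: measurable_normal_pdf].
have p0 (s x : R) : 0 <= x ^+ 2 * normal_pdf 0 s x.
  by rewrite mulr_ge0 ?sqr_ge0 ?normal_pdf_ge0.
have E (s : R) : (\int[normal_prob 0 s]_x (x ^+ 2)%:E =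
    \int[mu]_x (x ^+ 2 * normal_pdf 0 s x)%:E)%E.
  by rewrite ge0_integral_normal_prob.
have [C [C0 hC]] := sqr_normal_pdf_le R.
have fin1 : (\int[mu]_x (x ^+ 2 * normal_pdf (0:R) 1 x)%:E < +oo)%E.
  apply: (@le_lt_trans _ _ (\int[mu]_x (C%:E * (normal_pdf 0 2 x)%:E))%E).
    apply: ge0_le_integral => //.
    - by move=> x _; rewrite lee_fin.
    - by apply/measurable_EFinP; exact: mp.
    - apply: measurable_funeM; apply/measurable_EFinP; exact: measurable_normal_pdf.
    - by move=> x _; rewrite -EFinM lee_fin.
  rewrite integralZl//; last exact: integrable_normal_pdf.
  by rewrite integral_normal_pdf mule1 ltry.
exists (fine (\int[mu]_x (x ^+ 2 * normal_pdf 0 1 x)%:E)); split.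
  by apply: fine_ge0; apply: integral_ge0 => x _; rewrite lee_fin.
move=> s s0; rewrite E.
(* Under x = s y the Jacobian cancels against the peak of the density, and s^2 remains. *)
pose F := fun x : R => s * x.
have dF (x : R) : is_derive x 1 F s.
  by rewrite /F; apply: is_derive_eq; rewrite /GRing.scale/= mulr1.
have F'E : F^`()%classic = cst s by apply/funext => x; rewrite derive1E; have [_ ->] := dF x.
rewrite (@increasing_ge0_integration_by_substitutionT _ F (fun x => x ^+ 2 * normal_pdf 0 s x)).
- rewrite F'E EFinM fineK; last by rewrite ge0_fin_numE// integral_ge0// => x _; rewrite lee_fin.
  rewrite muleC -ge0_integralZl_EFin ?sqr_ge0//; first last.
  + by apply/measurable_EFinP; exact: mp.
  + by move=> x _; rewrite lee_fin.
  apply: eq_integral => x _; rewrite -EFinM /F; congr EFin; rewrite /= /cst.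
  rewrite !normal_pdfE ?oner_neq0 ?gt_eqF// /normal_fun.
  rewrite -[LHS]/((s * x) ^+ 2 * (normal_peak s * expR (- (s * x - 0) ^+ 2 / (s ^+ 2 *+ 2))) * s).
  rewrite !subr0.
  have -> : - (s * x) ^+ 2 / (s ^+ 2 *+ 2) = - x ^+ 2 / (1 ^+ 2 *+ 2).
    by rewrite expr1n; field; rewrite gt_eqF.
  have -> : normal_peak 1 = normal_peak s * s.
    have pk (r : R) : 0 < r -> normal_peak r = r^-1 * (Num.sqrt (pi *+ 2))^-1.
      by move=> r0; rewrite /normal_peak -mulrnAr sqrtrM ?sqr_ge0// sqrtr_sqr gtr0_norm// invfM.
    by rewrite !pk// invr1 mul1r mulrAC mulVf ?mul1r// gt_eqF.
  ring.
- by move=> x y xy; rewrite /F ltr_pM2l.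
- by rewrite F'E => ?; exact: cvg_cst.
- by rewrite F'E; exact: is_cvg_cst.
- by rewrite F'E; exact: is_cvg_cst.
- by move=> x; have [] := dF x.
- by rewrite /F; apply: gt0_cvgMrNy => //; exact: cvg_id.
- by rewrite /F; apply: gt0_cvgMry => //; exact: cvg_id.
- move=> x; apply: cvgM; first exact: sqr_continuous.
  by apply: continuous_normal_pdf; rewrite gt_eqF.
- by move=> x; exact: p0.
Qed.

Section brownian_covariance.
Context d (T : measurableType d) (R : realType) (P : probability T R).
Variable W : R -> {RV P >-> R}.
Hypothesis hW : standard_brownian_motion W.

(* The variances of the increments determine the covariance by polarization. *)
Lemma brownian_covariance : exists v : R, [/\ 0 <= v,
  forall t : R, 0 <= t -> (W t : T -> R) \in Lfun P 2%:E &
  forall s t : R, 0 <= s -> 0 <= t ->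
    \int[P]_w (W s w * W t w) = v * Num.min s t].
Proof.
have [v [v0 hv]] := normal_second_moment R.
have var (s t : R) : 0 <= s -> s < t ->
    (\int[P]_w ((W t w - W s w) ^+ 2)%:E = (v * (t - s))%:E)%E.
  move=> s0 st; have mX : measurable_fun setT ((W t \- W s)%R : T -> measurableTypeR R).
    exact: (measurable_funB (measurable_funPT (W t)) (measurable_funPT (W s))).
  pose X : {RV P >-> measurableTypeR R} :=
    @mfun_Sub _ _ T (measurableTypeR R) _ (mem_set mX).
  rewrite -[LHS](@ge0_integral_distribution _ _ _ _ _ P X (fun x : R => (x ^+ 2)%:E))//; first last.
  - by move=> y; rewrite lee_fin sqr_ge0.
  - by apply/measurable_EFinP; exact: measurable_funX.
  have -> : (v * (t - s) = v * Num.sqrt (t - s) ^+ 2)%R.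
    by rewrite sqr_sqrtr// subr_ge0 ltW.
  rewrite -hv ?sqrtr_gt0 ?subr_gt0//.
  apply: eq_measure_integral => A mA _.
  exact: (brownian_gaussian_increments hW s0 st mA).
have mW (t : R) : measurable_fun setT (W t) by [].
have var0 (t : R) : 0 <= t -> (\int[P]_w (W t w ^+ 2)%:E = (v * t)%:E)%E.
  rewrite le_eqVlt => /predU1P[<-|t0].
    rewrite mulr0; transitivity (\int[P]_(w in setT) cst 0 w)%E; last by rewrite integral0.
    apply: ge0_ae_eq_integral => //.
    - by apply/measurable_EFinP; exact: measurable_funX.
    - by move=> x _; rewrite lee_fin sqr_ge0.
    - have := brownian_start hW; apply: filterS => w /= Ww _.
      by rewrite Ww expr0n.
  rewrite -[in RHS](subr0 t) -var//; apply: ge0_ae_eq_integral => //.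
  - by apply/measurable_EFinP; exact: measurable_funX.
  - by apply/measurable_EFinP; apply: measurable_funX; exact: measurable_funB.
  - by move=> x _; rewrite lee_fin sqr_ge0.
  - by move=> x _; rewrite lee_fin sqr_ge0.
  - have := brownian_start hW; apply: filterS => w /= Ww _.
    by rewrite Ww subr0.
have lW (t : R) : 0 <= t -> (W t : T -> R) \in Lfun P 2%:E.
  by move=> t0; apply: Lfun2P => //; rewrite var0// ltry.
exists v; split => // s t s0 t0.
wlog st : s t s0 t0 / s <= t.
  move=> h; case/orP : (le_total s t) => st; first exact: h.
  by rewrite minC -h//; apply: eq_Rintegral => w _; rewrite mulrC.
have rsq (u : R) : 0 <= u -> \int[P]_w (W u w * W u w) = v * u.
  by move=> u0; rewrite -[RHS]/(fine (v * u)%:E) -var0//.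
move: st; rewrite le_eqVlt => /predU1P[<-|st]; first by rewrite minxx rsq.
have : \int[P]_w ((W t w - W s w) * (W t w - W s w)) = v * (t - s).
  by rewrite -[RHS]/(fine (v * (t - s))%:E) -var.
have lts := Lfun2B (lW _ t0) (lW _ s0).
rewrite Rintegral_mulBl ?lW//.
under eq_Rintegral do rewrite mulrC.
under [X in _ - X = _ -> _]eq_Rintegral do rewrite mulrC.
rewrite !Rintegral_mulBl ?lW// !rsq//.
under eq_Rintegral do rewrite mulrC.
rewrite min_l ?(ltW st)//; lra.
Qed.

End brownian_covariance.

(** * Pathwise integrals *)

(** The exponential series dominates its single term x^n / n!. *)
Lemma exprn_expRN_le (R : realType) (n : nat) (x : R) : 0 <= x ->
  x ^+ n * expR (- x) <= n`!%:R.
Proof.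
move=> x0; rewrite expRN ler_pdivrMr ?expR_gt0//.
case: n => [|n]; first by rewrite expr0 fact0 mul1r -expR0 ler_expR.
rewrite mulrC -ler_pdivrMr ?ltr0n ?fact_gt0//.
by apply: le_trans (expR_ge1Dxn n x0); rewrite lerDr.
Qed.

Section laplace_transform.
Context {R : realType}.
Variable H : R -> R.
Hypothesis mH : measurable_fun setT H.
Hypothesis H0 : forall x, x <= 0 -> H x = 0.
Hypothesis iH : mu.-integrable setT (fun x => (H x * Num.min 1 x)%:E).

Lemma integrable_mul_le_min (k : R -> R) (C : R) : measurable_fun setT k ->
  (forall x, 0 < x -> `|k x| <= C * Num.min 1 x) ->
  mu.-integrable setT (fun x => (H x * k x)%:E).
Proof.
move=> mk kC; apply: (le_integrable measurableT _ _ (integrableZl measurableT C iH)).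
- by apply/measurable_EFinP; exact: measurable_funM.
- move=> x _; rewrite -EFinM lee_fin mulrCA !normrM.
  have [x0|x0] := leP x 0; first by rewrite H0// normr0 !mul0r.
  rewrite ler_wpM2l// (le_trans (kC _ x0))// -normrM ler_norm//.
Qed.

(* Subtracting 1 when n = 0 makes the transform converge when H is only         *)
(* integrable against min 1 x; derivatives in t are not affected.              *)
Definition laplace_kernel (n : nat) (t x : R) : R :=
  x ^+ n * expR (- (x * t)) - (n == 0%N)%:R.

Lemma measurable_laplace_kernel n t : measurable_fun setT (laplace_kernel n t).
Proof.
apply: measurable_funB => //; apply: measurable_funM; first exact: measurable_funX.
by apply: measurableT_comp => //; apply: measurableT_comp => //; exact: measurable_funM.
Qed.

(** Uniform in t >= a. One summand bounds x^(n+1) e^(-xt) by a constant; the other bounds x^n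
    e^(-xt) after one factor x is split off, for small x. *)
Lemma laplace_kernelS_le n (a t x : R) : 0 < a -> a <= t -> 0 < x ->
  `|laplace_kernel n.+1 t x| <=
    (n.+1`!%:R / a ^+ n.+1 + n`!%:R / a ^+ n) * Num.min 1 x.
Proof.
move=> a0 at_ x0; rewrite /laplace_kernel/= subr0 ger0_norm ?mulr_ge0 ?exprn_ge0 ?expR_ge0 ?(ltW x0)//.
have bnd m : x ^+ m * expR (- (x * t)) <= m`!%:R / a ^+ m.
  rewrite ler_pdivlMr ?exprn_gt0// mulrAC -exprMn.
  have xa0 : 0 <= x * a by rewrite mulr_ge0// ltW.
  apply: (le_trans _ (exprn_expRN_le m xa0)).
  rewrite ler_wpM2l ?exprn_ge0 ?mulr_ge0 ?(ltW x0) ?(ltW a0)//.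
  by rewrite ler_expR lerN2 ler_wpM2l// ltW.
have p m : 0 <= m`!%:R / a ^+ m by rewrite divr_ge0// exprn_ge0// ltW.
rewrite minr_pMr ?addr_ge0// mulr1 le_min; apply/andP; split.
  by rewrite (le_trans (bnd _))// lerDl.
rewrite exprS -mulrA mulrC ler_wpM2r ?(ltW x0)//.
by rewrite (le_trans (bnd _))// lerDr.
Qed.

Lemma laplace_kernel0_le (t x : R) : 0 <= t -> 0 < x ->
  `|laplace_kernel 0 t x| <= (1 + t) * Num.min 1 x.
Proof.
move=> t0 x0; rewrite /laplace_kernel expr0 mul1r eqxx mulr1n.
have xt : 0 <= x * t by rewrite mulr_ge0// ltW.
rewrite distrC ger0_norm ?subr_ge0 -?[leRHS]expR0 ?ler_expR ?oppr_le0//.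
rewrite minr_pMr ?addr_ge0// mulr1 le_min; apply/andP; split.
  have := expR_ge0 (- (x * t)); lra.
have := expR_ge1Dx (- (x * t)); nra.
Qed.

(** The constant adds the bounds for n > 0 and for n = 0, so that a single formula serves both
    cases. *)
Lemma laplace_kernel_le n (a b t x : R) : 0 < a -> a <= t -> t <= b -> 0 < x ->
  `|laplace_kernel n t x| <=
    ((n`!%:R / a ^+ n + n.-1`!%:R / a ^+ n.-1) + (1 + b)) * Num.min 1 x.
Proof.
move=> a0 at_ tb x0.
have m0 : 0 <= Num.min 1 x by rewrite le_min ler01 ltW.
have p m : 0 <= m`!%:R / a ^+ m by rewrite divr_ge0// exprn_ge0// ltW.
rewrite mulrDl; case: n => [|n].
  apply: le_trans (laplace_kernel0_le _ x0) _; first by rewrite ltW// (lt_le_trans a0).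
  rewrite (@le_trans _ _ ((1 + b) * Num.min 1 x))// ?ler_wpM2r ?lerD2l//.
  by rewrite lerDr mulr_ge0// addr_ge0.
apply: le_trans (laplace_kernelS_le n a0 at_ x0) _.
by rewrite lerDl mulr_ge0// addr_ge0// ltW// (lt_le_trans a0)// (le_trans at_).
Qed.

Definition laplace n t : R := \int[mu]_x (H x * laplace_kernel n t x).

Lemma integrable_laplace n t : 0 < t ->
  mu.-integrable setT (fun x => (H x * laplace_kernel n t x)%:E).
Proof.
move=> t0; apply: integrable_mul_le_min => [|x x0].
  exact: measurable_laplace_kernel.
exact: (laplace_kernel_le n t0 (lexx t) (lexx t) x0).
Qed.

Lemma is_derive_laplace_kernel n (x t : R) :
  is_derive t 1 (fun t => H x * laplace_kernel n t x) (- (H x * laplace_kernel n.+1 t x)).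
Proof.
rewrite /laplace_kernel; apply: is_derive_eq.
by rewrite /GRing.scale /= exprS; ring.
Qed.

(** Differentiation under the integral on ]t/2, 2t[: staying away from 0 lets [laplace_kernelS_le]
    at a = t/2 supply one integrable majorant C |H(x) min(1, x)|. *)
Lemma is_derive_laplace n (t : R) : 0 < t ->
  is_derive t 1 (laplace n) (- laplace n.+1 t).
Proof.
move=> t0.
have It : `]t/2, t*2[%classic t by rewrite /= in_itv/=; lra.
have IH s : `]t/2, t*2[%classic s -> 0 < s /\ t/2 <= s <= t * 2.
  rewrite /= in_itv/=; lra.
have t20 : 0 < t/2 by lra.
pose C := ((n.+1`!%:R / (t/2) ^+ n.+1 + n`!%:R / (t/2) ^+ n)).
have intf s : `]t/2, t*2[%classic s -> mu.-integrable setT (EFin \o (fun x => H x * laplace_kernel n s x)).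
  by move=> /IH[s0 _]; exact: integrable_laplace.
have dk x s := is_derive_laplace_kernel n x s.
have derf s x : `]t/2, t*2[%classic s -> setT x -> derivable (fun t => H x * laplace_kernel n t x) s 1.
  by move=> _ _; have [] := dk x s.
have p1 s x : partial1of2 (fun t x => H x * laplace_kernel n t x) s x =
    - (H x * laplace_kernel n.+1 s x).
  by rewrite partial1of2E; have [_ ->] := dk x s.
pose G x : R := `|C * (H x * Num.min 1 x)|.
have intG : mu.-integrable setT (EFin \o G).
  by apply: integrable_norm; apply: (integrableZl measurableT C) iH.
have ub s x : `]t/2, t*2[%classic s -> setT x ->
    `|partial1of2 (fun t x => H x * laplace_kernel n t x) s x| <= G x.
  move=> /IH[s0 /andP[ts st]] _; rewrite p1 normrN /G mulrCA !normrM.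
  have [x0|x0] := leP x 0; first by rewrite H0// normr0 !mul0r.
  by rewrite ler_wpM2l// (le_trans (laplace_kernelS_le n t20 ts x0))// -normrM ler_norm.
have G0 x : 0 <= G x by exact: normr_ge0.
split; first exact: (derivable_under_integral measurableT It intf derf G0 intG ub).
rewrite -derive1E (differentiation_under_integral measurableT It intf derf G0 intG ub).
under eq_Rintegral do rewrite p1 -mulN1r.
by rewrite RintegralZl ?mulN1r//; exact: integrable_laplace.
Qed.


(* With a = alpha, this is the kappa of the header: x^(-a-1) kappa(x t) is minus *)
(* the derivative in x of (1 - e^(-xt)) x^(-a).                                *)
Definition potential_kernel (a x : R) : R := a * (1 - expR (- x)) - x * expR (- x).

(** For H(x) = x^(-a-1) V(w, x) this is the path of the smooth version at w. *)
Definition potential (a t : R) : R := \int[mu]_x (H x * potential_kernel a (x * t)).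

Lemma potentialE a t : 0 < t ->
  potential a t = - a * laplace 0 t + - 1 * t * laplace 1 t.
Proof.
move=> t0; rewrite /laplace -!RintegralZl//; [|exact: integrable_laplace..].
rewrite -RintegralD//=; first last.
- exact: (integrableZl measurableT _ (integrable_laplace 1 t0)).
- exact: (integrableZl measurableT _ (integrable_laplace 0 t0)).
apply: eq_Rintegral => x _; rewrite /potential_kernel /laplace_kernel expr0 expr1/=; ring.
Qed.

(** As L_n' = - L_(n+1), the derivative of b L_n + c t L_(n+1) is (c - b) L_(n+1) - c t L_(n+2),
    again of the same shape. *)
Lemma derive1n_potential a n : exists b c, forall t, 0 < t ->
  derive1n n (potential a) t = b * laplace n t + c * t * laplace n.+1 t.
Proof.
elim: n => [|n [b [c IH]]].
  by exists (- a), (-1) => t t0; rewrite derive1n0 potentialE.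
exists (c - b), (- c) => t t0; rewrite derive1nS derive1E.
have d0 := is_derive_laplace n t0; have d1 := is_derive_laplace n.+1 t0.
rewrite (@near_eq_derive _ _ _ _ (fun t => b * laplace n t + c * t * laplace n.+1 t)) ?oner_neq0//.
  rewrite derive_val /GRing.scale/=; ring.
by near=> s; apply: IH; near: s; exact: lt_nbhsr.
Unshelve. all: by end_near. Qed.

Lemma potential_smooth a : smooth_on_pos (potential a).
Proof.
move=> n t t0; have [b [c E]] := derive1n_potential a n.
apply: (@near_eq_derivable _ _ _ (fun t => b * laplace n t + c * t * laplace n.+1 t)).
  by near=> s; apply/esym/E; near: s; exact: lt_nbhsr.
have d0 := is_derive_laplace n t0; have d1 := is_derive_laplace n.+1 t0.
exact: ex_derive.
Unshelve. all: by end_near. Qed.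

Lemma measurable_potential_kernel (a t : R) :
  measurable_fun setT (fun x : R => potential_kernel a (x * t)).
Proof.
have mM : measurable_fun setT (fun x : R => x * t) by exact: measurable_funM.
have me : measurable_fun setT (fun x : R => expR (- (x * t))).
  by apply: measurableT_comp => //; exact: measurableT_comp.
apply: measurable_funB; last exact: measurable_funM.
by apply: measurable_funM => //; exact: measurable_funB.
Qed.

(** Since y e^(-y) <= 1 - e^(-y), both terms of kappa are controlled by 1 - e^(-xt), hence by
    [laplace_kernel0_le]. *)
Lemma potential_kernel_le (a t x : R) : 0 <= a -> 0 <= t -> 0 < x ->
  `|potential_kernel a (x * t)| <= (a + 1) * (1 + t) * Num.min 1 x.
Proof.
move=> a0 t0 x0; have xt : 0 <= x * t by rewrite mulr_ge0// ltW.
have := laplace_kernel0_le t0 x0; rewrite /laplace_kernel expr0 mul1r eqxx mulr1n.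
rewrite /potential_kernel distrC; set e := expR _; set m := (1 + t) * Num.min 1 x.
rewrite -(mulrA (a + 1)) -/m; have e0 : 0 <= e by exact: expR_ge0.
have xe1 : x * t * e <= 1 - e.
  have := ler_wpM2r e0 (expR_ge1Dx (x * t)).
  by rewrite /e expRxMexpNx_1; lra.
have xe0 : 0 <= x * t * e by rewrite mulr_ge0.
rewrite ler_norml => /andP[e1 e2].
have u1 : a * (1 - e) <= a * m by exact: ler_wpM2l.
have u2 : 0 <= a * (1 - e) by rewrite mulr_ge0// (le_trans xe0).
have u3 : 0 <= a * m by exact: le_trans u1.
by rewrite ler_norml mulrDl mul1r; apply/andP; split; lra.
Qed.

(** Half of the exponent is spent on absorbing the factor y of y e^(-y), through z e^(-z/2) <= 2.
    The bound is an increment of a monotone function, so it can be summed over disjoint intervals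
    without loss. *)
Lemma potential_kernel_lip (a x y : R) : 0 <= a -> 0 <= x -> x <= y ->
  `|potential_kernel a y - potential_kernel a x| <=
  (2 * a + 4) * (expR (- (x / 2)) - expR (- (y / 2))).
Proof.
move=> a0 x0 xy; rewrite /potential_kernel.
have E (z : R) : expR (- z) = expR (- (z / 2)) ^+ 2.
  by rewrite expr2 -expRD; congr expR; lra.
rewrite (E x) (E y).
have P (z : R) : 0 <= z -> [/\ 0 <= expR (- (z / 2)), expR (- (z / 2)) <= 1 & z * expR (- (z / 2)) <= 2].
  move=> z0; have z20 : 0 <= z / 2 by lra.
  split; first exact: expR_ge0.
    by rewrite -[leRHS]expR0 ler_expR; lra.
  have := @exprn_expRN_le _ 1 _ z20; rewrite expr1 (_ : 1`! = 1%N)//; lra.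
have [p0 p1 xp] := P x x0; have [q0 q1 yq] := P y (le_trans x0 xy).
have qp : expR (- (y / 2)) <= expR (- (x / 2)) by rewrite ler_expR; lra.
(* This is 1 + d <= e^d at d = (y - x) / 2, multiplied by 2 e^(-y/2). *)
have D : (y - x) * expR (- (y / 2)) <= 2 * (expR (- (x / 2)) - expR (- (y / 2))).
  have -> : - (x / 2) = - (y / 2) + (y - x) / 2 by lra.
  have : 0 <= expR (- (y / 2)) * (expR ((y - x) / 2) - (1 + (y - x) / 2)).
    by rewrite mulr_ge0// subr_ge0 expR_ge1Dx.
  rewrite expRD; lra.
move: p0 p1 xp q0 q1 yq qp D; set p := expR _; set q := expR _ => p0 p1 xp q0 q1 yq qp D.
have pq0 : 0 <= p - q by rewrite subr_ge0.
have apq : 0 <= a * (p - q) by rewrite mulr_ge0.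
have h1 : a * (p ^+ 2 - q ^+ 2) <= a * (p - q) * 2.
  by rewrite subr_sqr mulrA ler_wpM2l//; lra.
have h1' : 0 <= a * (p ^+ 2 - q ^+ 2).
  by rewrite subr_sqr mulrA mulr_ge0// addr_ge0.
have xq : x * q <= x * p by rewrite ler_wpM2l.
have h2 : x * p ^+ 2 - x * q ^+ 2 <= 4 * (p - q).
  have -> : x * p ^+ 2 - x * q ^+ 2 = (x * p + x * q) * (p - q) by ring.
  by rewrite ler_wpM2r//; lra.
have h3 : (y - x) * q * q <= (y - x) * q.
  by rewrite ler_piMr// mulr_ge0// subr_ge0.
have h4 : x * q ^+ 2 <= y * q ^+ 2 by rewrite ler_wpM2r// sqr_ge0.
have h5 : y * q ^+ 2 - x * p ^+ 2 <= 2 * (p - q).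
  have : x * q ^+ 2 <= x * p ^+ 2 by rewrite ler_wpM2l// lerXn2r.
  move: h3 D; rewrite (_ : (y - x) * q * q = y * q ^+ 2 - x * q ^+ 2); first lra.
  ring.
have pq4 : 0 <= (2 * a + 4) * (p - q) by rewrite mulr_ge0//; lra.
rewrite ler_norml; apply/andP; split; lra.
Qed.

End laplace_transform.

(** * Absolute continuity of the potential *)

Lemma disjoint_itvoo_le (R : realType) (a b c d : R) : a < b -> c < d ->
  [disjoint `]a, b[%classic & `]c, d[%classic] -> b <= c \/ d <= a.
Proof.
move=> ab cd /disj_set2P D; have [bc|cb] := leP b c; first by left.
have [da|ad] := leP d a; first by right.
exfalso; pose z := (Num.max a c + Num.min b d) / 2.
have mM : Num.max a c < Num.min b d by rewrite gt_max !lt_min ab cb ad cd.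
have [aM cM] : a <= Num.max a c /\ c <= Num.max a c by rewrite !le_max !lexx orbT.
have [bm dm] : Num.min b d <= b /\ Num.min b d <= d by rewrite !ge_min !lexx orbT.
suff : (`]a, b[%classic `&` `]c, d[%classic) z by rewrite D.
by rewrite /z; split; rewrite /= in_itv/=; apply/andP; split; lra.
Qed.

(** The intervals come in no particular order. Instead of sorting them, compare Lebesgue measures:
    the open intervals ]phi(v_i), phi(u_i)[ are pairwise disjoint and lie in [phi b, phi a]. *)
Lemma sum_nonincreasing_le (R : realType) (phi : R -> R) (a b : R) (n : nat) (u v : nat -> R) :
  {in `[a, b] &, {homo phi : x y /~ x <= y}} -> a <= b ->
  (forall i, (i < n)%N -> a <= u i /\ u i <= v i /\ v i <= b) ->
  trivIset `I_n (fun i => `]u i, v i[%classic) ->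
  \sum_(i < n) (phi (u i) - phi (v i)) <= phi a - phi b.
Proof.
move=> hphi ab uv tuv.
have inab i : (i < n)%N -> u i \in `[a, b] /\ v i \in `[a, b].
  by move=> /uv[h1 [h2 h3]]; rewrite !in_itv/=; split; apply/andP; split => //;
    [exact: le_trans h3|exact: le_trans h2].
have uvphi i : (i < n)%N -> phi (v i) <= phi (u i).
  by move=> ni; have [h1 h2] := inab _ ni; have [_ [h _]] := uv _ ni; exact: hphi.
have aI : a \in `[a, b] by rewrite in_itv/= lexx.
have bI : b \in `[a, b] by rewrite in_itv/= lexx andbT.
pose A (i : 'I_n) : set R := `]phi (v i), phi (u i)[%classic.
have mA i : measurable (A i) by exact: measurable_itv.
have muA i : mu (A i) = (phi (u i) - phi (v i))%:E.
  rewrite lebesgue_measure_itv/= lte_fin; case: ltP => // h.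
  have -> : phi (u i) = phi (v i) by apply/le_anti; rewrite h uvphi.
  by rewrite subrr.
have tA : trivIset setT A.
  apply/trivIsetP => i j _ _ ij; apply/seteqP; split => // z [].
  rewrite /A/= !in_itv/= => /andP[zi1 zi2] /andP[zj1 zj2].
  (* Degenerate intervals have empty images, so a common point of two images forces both intervals
     to be nondegenerate, as [disjoint_itvoo_le] requires. *)
  have lt_uv k : phi (v k) < phi (u k) -> (k < n)%N -> u k < v k.
    move=> vu kn; rewrite ltNge; apply/negP => h.
    have [h1 h2] := inab _ kn; have := hphi _ _ h1 h2 h.
    by rewrite leNgt vu.
  have [iu iv] := inab i (ltn_ord i); have [ju jv] := inab j (ltn_ord j).
  have D : [disjoint `]u i, v i[%classic & `]u j, v j[%classic].
    by apply/disj_set2P; move/trivIsetP : tuv => /(_ i j (ltn_ord i) (ltn_ord j) ij).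
  have [h|h] := disjoint_itvoo_le (lt_uv i (lt_trans zi1 zi2) (ltn_ord i))
    (lt_uv j (lt_trans zj1 zj2) (ltn_ord j)) D.
  - by have := hphi _ _ ju iv h; rewrite leNgt (lt_trans zi1).
  - by have := hphi _ _ iu jv h; rewrite leNgt (lt_trans zj1).
rewrite -lee_fin -sumEFin.
under eq_bigr do rewrite -muA.
rewrite -(measure_bigsetU_ord mu xpredT mA tA).
apply: (@le_trans _ _ (mu `[phi b, phi a]%classic)).
  apply: le_measure; rewrite ?inE; [by apply: bigsetU_measurable => i _; exact: mA|exact: measurable_itv|].
  elim/big_ind : _ => [|B C hB hC|i _]; [exact: sub0set|by rewrite subUset|].
  move=> z; rewrite /A/= !in_itv/= => /andP[z1 z2].
  have [iu iv] := inab i (ltn_ord i); have [h1 [h2 h3]] := uv i (ltn_ord i).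
  by rewrite (le_trans _ (ltW z1)) ?hphi// (le_trans (ltW z2))// hphi.
rewrite lebesgue_measure_itv/= lte_fin; case: ltP => // h.
by rewrite lee_fin subr_ge0 hphi.
Qed.

(** The bound 1 is the total variation of a monotone function with values in [0, 1]; the other bound
    is the Lipschitz estimate, applied term by term. *)
Lemma sum_expRN_le_min (R : realType) (x : R) (n : nat) (u v : nat -> R) (b : R) :
  0 <= x -> 0 <= b ->
  (forall i, (i < n)%N -> 0 <= u i /\ u i <= v i /\ v i <= b) ->
  trivIset `I_n (fun i => `]u i, v i[%classic) ->
  \sum_(i < n) (expR (- (x * u i / 2)) - expR (- (x * v i / 2))) <=
    Num.min 1 (x * \sum_(i < n) (v i - u i)).
Proof.
move=> x0 b0 uv tuv; rewrite le_min; apply/andP; split.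
  have hphi : {in `[0, b] &, {homo (fun s => expR (- (x * s / 2))) : x y /~ x <= y}}.
    move=> s t _ _ st; rewrite ler_expR; nra.
  apply: le_trans (sum_nonincreasing_le hphi b0 uv tuv) _.
  by rewrite mulr0 mul0r oppr0 expR0 lerBlDr lerDl expR_ge0.
rewrite mulr_sumr; apply: ler_sum => i _.
have [h1 [h2 _]] := uv i (ltn_ord i).
have := expR_ge1Dx (- (x * (v i - u i) / 2)).
have -> : - (x * v i / 2) = - (x * u i / 2) + - (x * (v i - u i) / 2) by lra.
rewrite expRD.
have : expR (- (x * u i / 2)) <= 1.
  by rewrite -expR0 ler_expR oppr_le0; rewrite divr_ge0// mulr_ge0.
have := expR_ge0 (- (x * u i / 2)).
have := expR_ge0 (- (x * (v i - u i) / 2)).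
have : 0 <= x * (v i - u i) by rewrite mulr_ge0// subr_ge0.
set d := x * (v i - u i); set p := expR _; set q := expR _.
nra.
Qed.

Section potential_ac.
Context {R : realType}.
Variable H : R -> R.
Hypothesis mH : measurable_fun setT H.
Hypothesis H0 : forall x, x <= 0 -> H x = 0.
Hypothesis iH : mu.-integrable setT (fun x => (H x * Num.min 1 x)%:E).


Let cvg_integral_min_scale :
  (\int[mu]_x `|H x * Num.min 1 (x * n.+1%:R^-1)|%:E)%E @[n --> \oo] --> 0%E.
Proof.
rewrite -[X in _ --> X](integral0 mu setT).
apply: (@dominated_cvg _ (measurableTypeR R) R mu setT measurableT
  (fun n x => `|H x * Num.min 1 (x * n.+1%:R^-1)|%:E) (cst 0%E) (fun x => `|H x * Num.min 1 x|%:E)) => //=.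
- move=> n; apply/measurable_EFinP; apply: measurableT_comp => //.
  apply: measurable_funM => //; apply: measurable_minr => //; exact: measurable_funM.
- move=> x _; have [x0|x0] := leP x 0.
    by rewrite H0//; under eq_fun do rewrite mul0r normr0; exact: cvg_cst.
  apply: cvg_EFin; first exact: nearW.
  rewrite -[0 in X in _ --> X](normr0 R) -[X in `|X|](mulr0 (H x)).
  apply: cvg_norm; apply: cvgM; first exact: cvg_cst.
  apply: (@squeeze_cvgr _ _ _ _ (cst 0) (fun n => x * n.+1%:R^-1)).
  + near=> n; rewrite /= le_min ler01 ge_min lexx orbT andbT.
    by rewrite mulr_ge0// ltW.
  + exact: cvg_cst.
  + by rewrite -[X in _ --> X](mulr0 x); apply: cvgM; [exact: cvg_cst|exact: cvg_harmonic].
- exact: (integrable_norm iH).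
- move=> n x _; rewrite normr_id lee_fin !normrM.
  have [x0|x0] := leP x 0; first by rewrite H0// normr0 !mul0r.
  rewrite ler_wpM2l// !ger0_norm ?le_min ?ler01 ?(ltW x0) ?mulr_ge0 ?(ltW x0)//=.
  rewrite ge_min lexx/= ge_min; apply/orP; right.
  by rewrite ler_piMr ?(ltW x0)// invf_le1// ler1n.
Unshelve. all: by end_near. Qed.

Lemma potential_absolutely_continuous (a : R) : 0 <= a ->
  absolutely_continuous_half_line (potential H a).
Proof.
move=> a0 b b0 e e0; pose C := 2 * a + 4.
have C0 : 0 < C by rewrite /C; lra.
(* By dominated convergence. With delta = 1 / (n + 1), C times this integral bounds the sum of the
   increments. *)
have [n nd] : exists n, (\int[mu]_x `|H x * Num.min 1 (x * n.+1%:R^-1)|%:E < (e / C)%:E)%E.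
  have eC : (0 < (e / C)%:E)%E by rewrite lte_fin divr_gt0.
  have : \forall n \near \oo, (\int[mu]_x `|H x * Num.min 1 (x * n.+1%:R^-1)|%:E < (e / C)%:E)%E.
    exact: (cvg_integral_min_scale (open_ereal_lt' eC)).
  by move=> [N _ hN]; exists N; apply: hN => /=.
exists n.+1%:R^-1; first by rewrite invr_gt0.
move=> m u v uv tuv Suv.
have iK (t : R) : 0 <= t -> mu.-integrable setT (fun x => (H x * potential_kernel a (x * t))%:E).
  move=> t0; apply: (integrable_mul_le_min mH H0 iH (C := (a + 1) * (1 + t))).
    exact: measurable_potential_kernel.
  by move=> x x0; exact: potential_kernel_le.
pose D (i : nat) x := H x * potential_kernel a (x * v i) - H x * potential_kernel a (x * u i).
have mK (t : R) : measurable_fun setT (fun x : R => H x * potential_kernel a (x * t)).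
  by apply: measurable_funM => //; exact: measurable_potential_kernel.
have mD i : measurable_fun setT (D i) by apply: measurable_funB.
rewrite -lte_fin -sumEFin.
apply: (@le_lt_trans _ _ (\sum_(i < m) \int[mu]_x `|D i x|%:E)%E).
  apply: lee_sum => i _.
  have [h1 [h2 h3]] := uv i (ltn_ord i).
  have h0 : 0 <= v i by exact: le_trans h2.
  rewrite /potential -RintegralB//; [|exact: iK..].
  rewrite EFin_normr_Rintegral//; last first.
    exact: (integrableB measurableT (iK _ h0) (iK _ h1)).
  apply: le_trans (le_abse_integral _ _ _) _ => //.
  by apply/measurable_EFinP; exact: mD.
apply: (@le_lt_trans _ _ (\int[mu]_x (\sum_(i < m) `|D i x|%:E))%E).
  rewrite ge0_integral_sum// => i.
  by apply/measurable_EFinP; apply: measurableT_comp => //; exact: mD.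
apply: (@le_lt_trans _ _ (C%:E * \int[mu]_x `|H x * Num.min 1 (x * n.+1%:R^-1)|%:E)%E); last first.
  rewrite (_ : e%:E = (C%:E * (e / C)%:E)%E); first by rewrite lte_pmul2l.
  by rewrite -EFinM mulrC divfK// gt_eqF.
have mM : measurable_fun setT (fun x : R => H x * Num.min 1 (x * n.+1%:R^-1)).
  by apply: measurable_funM => //; apply: measurable_minr => //; exact: measurable_funM.
rewrite -ge0_integralZl_EFin ?(ltW C0)//; last first.
  by apply/measurable_EFinP; apply: measurableT_comp => //; exact: mM.
apply: ge0_le_integral => //.
- by move=> x _; apply: sume_ge0 => i _; rewrite lee_fin.
- by apply: emeasurable_sum => i; apply/measurable_EFinP; apply: measurableT_comp => //; exact: mD.
- by apply/measurable_EFinP; apply: measurable_funM => //; exact: measurableT_comp.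
move=> x _; rewrite sumEFin -EFinM lee_fin.
have [x0|x0] := leP x 0.
  rewrite big1 => [|i _]; last by rewrite /D H0// !mul0r subrr normr0.
  by rewrite mulr_ge0// ltW.
apply: (@le_trans _ _ (\sum_(i < m) `|H x| * C * (expR (- (x * u i / 2)) - expR (- (x * v i / 2))))).
  apply: ler_sum => i _; have [h1 [h2 h3]] := uv i (ltn_ord i).
  rewrite /D -mulrBr normrM -mulrA ler_wpM2l// potential_kernel_lip//.
    by rewrite mulr_ge0// ltW.
  by rewrite ler_wpM2l// ltW.
rewrite -mulr_sumr (mulrC _ C) -mulrA normrM ler_wpM2l ?(ltW C0)// ler_wpM2l//.
apply: le_trans (sum_expRN_le_min (ltW x0) b0 uv tuv) _.
apply: le_trans (ler_norm _); rewrite le_min !ge_min lexx/=.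
by rewrite ler_wpM2l ?orbT// ltW.
Qed.

End potential_ac.

(** * Integrals of a process against a deterministic kernel *)

(** Sections are not assumed integrable: Tonelli applies to the positive and negative parts
    separately. *)
Lemma measurable_Rintegral_section d1 d2 (T1 : measurableType d1) (T2 : measurableType d2)
    (R : realType) (m2 : {sigma_finite_measure set T2 -> \bar R}) (f : T1 * T2 -> R) :
  measurable_fun setT f ->
  measurable_fun setT (fun x => \int[m2]_y f (x, y)).
Proof.
move=> mf.
have mE : measurable_fun setT (EFin \o f) by exact/measurable_EFinP.
have mI : measurable_fun setT (fun x => \int[m2]_y (f (x, y))%:E)%E.
  rewrite (_ : (fun _ => _) = (fun x => \int[m2]_y ((EFin \o f)^\+ (x, y)) -
      \int[m2]_y ((EFin \o f)^\- (x, y)))%E); last first.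
    apply/funext => x; rewrite [LHS]integralE.
    by congr (_ - _)%E; apply: eq_integral => y _; rewrite ?funeposE ?funenegE.
  apply: emeasurable_funB.
  - by apply: (measurable_fun_fubini_tonelli_F (EFin \o f)^\+%E) => //; exact: measurable_funepos.
  - by apply: (measurable_fun_fubini_tonelli_F (EFin \o f)^\-%E) => //; exact: measurable_funeneg.
exact: measurableT_comp mI.
Qed.

Lemma normr_le_weighted (R : realType) (l s a : R) : 0 < l -> 0 < s ->
  `|a| <= (l * s + a ^+ 2 / s / l) / 2.
Proof.
move=> l0 s0; rewrite -[a ^+ 2]real_normK ?num_real//; set b := `|a|.
rewrite -subr_ge0 (_ : _ - _ = (l * s - b) ^+ 2 / (2 * s * l)).
  by rewrite divr_ge0 ?sqr_ge0// mulr_ge0 ?(ltW l0)// mulr_ge0// ltW.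
by field; rewrite !gt_eqF.
Qed.

Lemma measurable_invr_sqrt (R : realType) :
  measurable_fun setT (fun x : R => (Num.sqrt x)^-1).
Proof.
rewrite (_ : (fun _ => _) = fun x : R => \1_`]0, +oo[ x * x `^ (- 2^-1)).
  by apply: measurable_funM; [exact: measurable_indic|exact: measurable_powR].
apply/funext => x; rewrite indicE; have [x0|x0] := leP x 0.
  by rewrite ler0_sqrtr// invr0 memNset ?mul0r//= in_itv/= andbT; apply/negP; rewrite -leNgt.
by rewrite mem_set ?mul1r/= ?in_itv/= ?x0// powRN powR12_sqrt// ltW.
Qed.

Section averaged_process.
Context d (T : measurableType d) (R : realType) (P : probability T R).
Variables (V : T * R -> R) (v : R) (g : R -> R).
Hypothesis mV : measurable_fun setT V.
Hypothesis v0 : 0 <= v.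
Hypothesis lV : forall a, 0 < a -> (fun w => V (w, a)) \in Lfun P 2%:E.
Hypothesis cV : forall a b, 0 < a -> 0 < b ->
  \int[P]_w (V (w, a) * V (w, b)) = v * Num.min a b.
Hypothesis mg : measurable_fun setT g.
Hypothesis g0 : forall x, x <= 0 -> g x = 0.
Hypothesis ig : mu.-integrable setT (fun x => (g x * Num.sqrt x)%:E).
Hypothesis igV2 : forall w,
  mu.-integrable setT (fun x => (g x * (V (w, x) ^+ 2 / Num.sqrt x))%:E).

Let mVw w : measurable_fun setT (fun x => V (w, x)).
Proof. exact: measurableT_comp. Qed.

Let m_sqrt : measurable_fun setT (@Num.sqrt R).
Proof. exact: continuous_measurable_fun (@sqrt_continuous R). Qed.

Let M := \int[mu]_x `|g x * Num.sqrt x|.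
Let B w := \int[mu]_x `|g x * (V (w, x) ^+ 2 / Num.sqrt x)|.

(** The weight sqrt x is the order of the standard deviation of V_x: V_x^2 / sqrt x has mean v sqrt
    x, so both terms on the right are under control. The scale l stays free for optimization. *)
Let norm_gV_le (l : R) w x : 0 < l ->
  `|g x * V (w, x)| <= (l * `|g x * Num.sqrt x| +
    `|g x * (V (w, x) ^+ 2 / Num.sqrt x)| / l) / 2.
Proof.
move=> l0; have [x0|x0] := leP x 0; first by rewrite g0// !mul0r normr0 mulr0 mul0r addr0 mul0r.
have s0 : 0 < Num.sqrt x by rewrite sqrtr_gt0.
rewrite (normrM (g x) (V (w, x))) (normrM (g x) (Num.sqrt x)) (ger0_norm (ltW s0)).
rewrite (normrM (g x)) (@ger0_norm _ (V (w, x) ^+ 2 / _)) ?divr_ge0 ?sqr_ge0 ?(ltW s0)//.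
apply: le_trans (ler_wpM2l _ (normr_le_weighted (V (w, x)) l0 s0)) _ => //.
by rewrite le_eqVlt; apply/orP; left; apply/eqP; ring.
Qed.

Let i_bound (l : R) w : mu.-integrable setT (fun x => ((l * `|g x * Num.sqrt x| +
    `|g x * (V (w, x) ^+ 2 / Num.sqrt x)| / l) / 2)%:E).
Proof.
have h1 := integrableZl measurableT l (integrable_norm ig).
have h2 := integrableZr measurableT l^-1 (integrable_norm (igV2 w)).
exact: (integrableZr measurableT 2^-1 (integrableD measurableT h1 h2)).
Qed.

Lemma integrable_averaged w : mu.-integrable setT (fun x => (g x * V (w, x))%:E).
Proof.
apply: le_integrable (i_bound 1 w) => //.
  by apply/measurable_EFinP; apply: measurable_funM => //; exact: mVw.
move=> x _; rewrite lee_fin; apply: le_trans (norm_gV_le w x ltr01) _.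
exact: ler_norm.
Qed.

Definition averaged w : R := \int[mu]_x (g x * V (w, x)).

Let m_gV : measurable_fun setT (fun wx : T * R => g wx.2 * V wx).
Proof. by apply: measurable_funM => //; exact: measurableT_comp. Qed.

Lemma measurable_averaged : measurable_fun setT averaged.
Proof. refine (@measurable_Rintegral_section _ _ T (measurableTypeR R) R mu _ m_gV). Qed.

(** Pathwise Cauchy-Schwarz for the splitting V = sqrt(sqrt x) (V / sqrt(sqrt x)); M + 1 replaces M
    to keep a division legitimate. *)
Let averaged_sqr_le w : averaged w ^+ 2 <= (M + 1) * B w.
Proof.
have M0 : 0 <= M by apply: Rintegral_ge0.
have B0 : 0 <= B w by apply: Rintegral_ge0.
have bound (l : R) : 0 < l -> `|averaged w| <= (l * M + B w / l) / 2.
  move=> l0; apply: le_trans (le_normr_Rintegral _ (integrable_averaged w)) _ => //.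
  have h1 := integrableZl measurableT l (integrable_norm ig).
  have h2 := integrableZr measurableT l^-1 (integrable_norm (igV2 w)).
  rewrite /M /B -RintegralZl//; last exact: integrable_norm ig.
  rewrite -RintegralZr//; last exact: integrable_norm (igV2 w).
  rewrite -RintegralD// -RintegralZr//; last exact: (integrableD measurableT h1 h2).
  apply: le_Rintegral => //.
  - exact: integrable_norm (integrable_averaged w).
  - exact: i_bound.
  - by move=> x _; exact: norm_gV_le.
have [->|z0] := eqVneq (averaged w) 0; first by rewrite expr0n mulr_ge0// addr_ge0.
have a0 : 0 < `|averaged w| by rewrite normr_gt0.
have M1 : 0 < M + 1 by rewrite ltr_wpDl.
(* The choice l = |averaged w| / (M + 1) avoids Cauchy-Schwarz. *)
have := bound _ (divr_gt0 a0 M1).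
rewrite -[averaged w ^+ 2]real_normK ?num_real//; move: a0; set a := `|averaged w| => a0.
rewrite ler_pdivlMr// invfM invrK mulrA => h.
have h1 : a / (M + 1) * M <= a by rewrite mulrAC ler_pdivrMr// ler_wpM2l ?(ltW a0)// lerDl.
have h2 : a <= B w * a^-1 * (M + 1) by move: h; rewrite (mulrC (B w * _)); lra.
by move: h2; rewrite mulrAC ler_pdivlMr// expr2 (mulrC (B w)).
Qed.

Let cVE a : 0 < a -> (\int[P]_w (V (w, a) ^+ 2)%:E = (v * a)%:E)%E.
Proof.
move=> a0; rewrite -[LHS]fineK ?fin_num_integral_sqr ?lV//.
rewrite -[in RHS](minxx a) -cV//; congr EFin.
Qed.

(** By Tonelli the expectation of B is v times M. *)
Let integral_B : (\int[P]_w (B w)%:E < +oo)%E.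
Proof.
have mF : measurable_fun setT (fun wx : T * R => `|g wx.2 * (V wx ^+ 2 / Num.sqrt wx.2)|%:E).
  apply/measurable_EFinP; apply: measurableT_comp => //; apply: measurable_funM.
    exact: measurableT_comp.
  apply: measurable_funM; first exact: measurable_funX.
  exact: (measurableT_comp (@measurable_invr_sqrt R)).
have -> : (\int[P]_w (B w)%:E = \int[P]_w \int[mu]_x `|g x * (V (w, x) ^+ 2 / Num.sqrt x)|%:E)%E.
  apply: eq_integral => w _; rewrite fineK//.
  exact: (integrable_fin_num measurableT (integrable_norm (igV2 w))).
rewrite (@fubini_tonelli _ _ T (measurableTypeR R) R P mu (fun wx : T * R => `|g wx.2 * (V wx ^+ 2 / Num.sqrt wx.2)|%:E))//.
have E (x : R) : (\int[P]_w `|g x * (V (w, x) ^+ 2 / Num.sqrt x)|%:E =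
    v%:E * `|g x * Num.sqrt x|%:E)%E.
  have [x0|x0] := leP x 0.
    under eq_integral do rewrite g0// mul0r normr0.
    by rewrite integral0 g0// mul0r normr0 mule0.
  have s0 : 0 < Num.sqrt x by rewrite sqrtr_gt0.
  transitivity (\int[P]_w ((`|g x| / Num.sqrt x)%:E * (V (w, x) ^+ 2)%:E))%E.
    apply: eq_integral => w _; rewrite -EFinM (normrM (g x)).
    by rewrite (@ger0_norm _ (_ / _)) ?divr_ge0 ?sqr_ge0 ?(ltW s0)// [in LHS]mulrA [in LHS]mulrAC.
  rewrite ge0_integralZl_EFin ?divr_ge0 ?(ltW s0)//; first last.
  - by apply/measurable_EFinP/measurable_funX; exact: Lfun_measurable (lV x0).
  - by move=> w _; rewrite lee_fin sqr_ge0.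
  rewrite cVE// -!EFinM normrM (ger0_norm (ltW s0)); congr EFin.
  rewrite -[X in v * X](sqr_sqrtr (ltW x0)); field; rewrite gt_eqF//.
under eq_integral do rewrite E.
rewrite integralZl//; last exact: integrable_norm ig.
apply: lte_mul_pinfty => //.
  by have /integrableP[_] := ig.
Qed.

Lemma averaged_Lfun2 : averaged \in Lfun P 2%:E.
Proof.
apply: Lfun2P; first exact: measurable_averaged.
have mB : measurable_fun setT B.
  refine (@measurable_Rintegral_section _ _ T (measurableTypeR R) R mu
    (fun wx => `|g wx.2 * (V wx ^+ 2 / Num.sqrt wx.2)|) _).
  apply: measurableT_comp => //; apply: measurable_funM.
    exact: measurableT_comp.
  apply: measurable_funM; first exact: measurable_funX.
  exact: (measurableT_comp (@measurable_invr_sqrt R)).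
apply: (@le_lt_trans _ _ (\int[P]_w ((M + 1)%:E * (B w)%:E))%E).
  apply: ge0_le_integral => //.
  - by move=> w _; rewrite lee_fin sqr_ge0.
  - by apply/measurable_EFinP/measurable_funX; exact: measurable_averaged.
  - by apply/measurable_EFinP; exact: measurable_funM.
  - by move=> w _; rewrite -EFinM lee_fin.
have M1 : 0 <= M + 1 by rewrite addr_ge0//; apply: Rintegral_ge0.
rewrite ge0_integralZl_EFin//; [|by move=> w _; rewrite lee_fin; apply: Rintegral_ge0|exact/measurable_EFinP].
by apply: lte_mul_pinfty.
Qed.

(** Fubini. Absolute integrability comes from 2 |V_x Q| <= V_x^2 / sqrt x + sqrt x Q^2, whose
    expectation is (v + E Q^2) sqrt x. *)
Lemma Rintegral_averaged_mul (Q : T -> R) : Q \in Lfun P 2%:E ->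
  \int[P]_w (averaged w * Q w) = \int[mu]_x (g x * \int[P]_w (V (w, x) * Q w)).
Proof.
move=> lQ; have mQ := Lfun_measurable lQ.
pose F (wx : T * measurableTypeR R) := (g wx.2 * V wx * Q wx.1)%:E.
have mF : measurable_fun setT F.
  apply/measurable_EFinP; apply: measurable_funM; first exact: m_gV.
  exact: measurableT_comp.
have mFa : measurable_fun setT (abse \o F) by exact: measurableT_comp.
pose q := \int[P]_w (Q w ^+ 2).
have qE : (\int[P]_w (Q w ^+ 2)%:E = q%:E)%E by rewrite fineK// fin_num_integral_sqr.
have iF : (P \x mu)%E.-integrable setT F.
  apply/(integrable21ltyP P (mu : {sigma_finite_measure set (measurableTypeR R) -> \bar R}) mF).
  apply: (@le_lt_trans _ _ (\int[mu]_x (((v + q) / 2)%:E * `|g x * Num.sqrt x|%:E))%E); last first.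
    rewrite integralZl//; last exact: integrable_norm ig.
    apply: lte_mul_pinfty => //; last by have /integrableP[_] := ig.
    by rewrite lee_fin divr_ge0// addr_ge0// Rintegral_ge0// => w _; exact: sqr_ge0.
  apply: ge0_le_integral => //.
  - by move=> x _; exact: integral_ge0.
  - refine (@measurable_fun_fubini_tonelli_G _ _ T (measurableTypeR R) R P (abse \o F) mFa _).
    by move=> z; exact: abse_ge0.
  - exact: (measurable_int mu (integrableZl measurableT _ (integrable_norm ig))).
  move=> x _; have [x0|x0] := leP x 0.
    under eq_integral do rewrite /F/= g0// !mul0r normr0.
    by rewrite integral0 g0// mul0r normr0 mule0.
  have s0 : 0 < Num.sqrt x by rewrite sqrtr_gt0.
  have mVx := Lfun_measurable (lV x0).
  have mVQ : measurable_fun setT (fun w => g x * V (w, x) * Q w).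
    by apply: measurable_funM => //; exact: measurable_funM.
  have mV2 : measurable_fun setT (fun w => (V (w, x) ^+ 2)%:E).
    by apply/measurable_EFinP; exact: measurable_funX.
  have mQ2 : measurable_fun setT (fun w => (Q w ^+ 2)%:E).
    by apply/measurable_EFinP; exact: measurable_funX.
  have k1 : 0 <= `|g x| / Num.sqrt x / 2 by rewrite !divr_ge0// ltW.
  have k2 : 0 <= `|g x| * Num.sqrt x / 2 by rewrite divr_ge0// mulr_ge0// ltW.
  apply: (@le_trans _ _ (\int[P]_w ((`|g x| / Num.sqrt x / 2)%:E * (V (w, x) ^+ 2)%:E +
      (`|g x| * Num.sqrt x / 2)%:E * (Q w ^+ 2)%:E))%E).
    apply: ge0_le_integral => //.
    - by apply: measurableT_comp => //; apply/measurable_EFinP; exact: mVQ.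
    - by apply: emeasurable_funD; exact: measurable_funeM.
    move=> w _; rewrite /F /= lee_fin (normrM (_ * _)) (normrM (g x)) -mulrA.
    apply: (@le_trans _ _ (`|g x| * ((V (w, x) ^+ 2 / Num.sqrt x + Num.sqrt x * Q w ^+ 2) / 2))).
      rewrite ler_wpM2l// -[V (w, x) ^+ 2]real_normK ?num_real// -[Q w ^+ 2]real_normK ?num_real//.
      set a := `|V (w, x)|; set b := `|Q w|.
      rewrite -subr_ge0 (_ : _ - _ = (a - Num.sqrt x * b) ^+ 2 / (2 * Num.sqrt x)).
        by rewrite divr_ge0 ?sqr_ge0// mulr_ge0// ltW.
      by field; rewrite gt_eqF.
    by rewrite le_eqVlt; apply/orP; left; apply/eqP; ring.
  rewrite ge0_integralD//; first last.
  - exact: measurable_funeM.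
  - by move=> w _; rewrite -EFinM lee_fin mulr_ge0// sqr_ge0.
  - exact: measurable_funeM.
  - by move=> w _; rewrite -EFinM lee_fin mulr_ge0// sqr_ge0.
  rewrite !ge0_integralZl_EFin//; first last.
  - by move=> w _; rewrite lee_fin sqr_ge0.
  - by move=> w _; rewrite lee_fin sqr_ge0.
  rewrite cVE// qE -!EFinM -EFinD lee_fin normrM (ger0_norm (ltW s0)).
  rewrite -[X in v * X](sqr_sqrtr (ltW x0)) le_eqVlt; apply/orP; left; apply/eqP.
  by field; rewrite gt_eqF.
have := Fubini iF; rewrite /F/= => FE.
have E1 : (\int[P]_w \int[mu]_x (g x * V (w, x) * Q w)%:E = \int[P]_w (averaged w * Q w)%:E)%E.
  apply: eq_integral => w _.
  under eq_integral do rewrite EFinM.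
  rewrite integralZr//; last exact: integrable_averaged.
  by rewrite EFinM fineK// (integrable_fin_num measurableT (integrable_averaged w)).
have E2 : (\int[mu]_x \int[P]_w (g x * V (w, x) * Q w)%:E =
    \int[mu]_x (g x * \int[P]_w (V (w, x) * Q w))%:E)%E.
  apply: eq_integral => x _; have [x0|x0] := leP x 0.
    by under eq_integral do rewrite g0// !mul0r; rewrite integral0 g0// mul0r.
  under eq_integral do rewrite -mulrA EFinM.
  have iVQ := integrable_mul_Lfun2 (lV x0) lQ.
  rewrite integralZl//.
  by rewrite EFinM fineK// (integrable_fin_num measurableT iVQ).
by rewrite /Rintegral -E1 FE E2.
Qed.

End averaged_process.

(** * Identification with the Wiener integral *)

Lemma Lfun2_sum d (T : measurableType d) (R : realType) (m : {measure set T -> \bar R})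
    (I : eqType) (s : seq I) (h : I -> T -> R) :
  (forall i, i \in s -> h i \in Lfun m 2%:E) ->
  (fun x => \sum_(i <- s) h i x) \in Lfun m 2%:E.
Proof.
elim: s => [_|i s IH hs].
  under eq_fun do rewrite big_nil.
  by apply: Lfun2P => //; rewrite expr0n; under eq_integral do []; rewrite integral0.
under eq_fun do rewrite big_cons.
apply: Lfun2D; first by apply: hs; rewrite mem_head.
by apply: IH => j js; apply: hs; rewrite inE js orbT.
Qed.

Lemma Rintegral_mul_suml d (T : measurableType d) (R : realType) (m : {measure set T -> \bar R})
    (I : eqType) (s : seq I) (h : I -> T -> R) (k : T -> R) :
  (forall i, i \in s -> h i \in Lfun m 2%:E) -> k \in Lfun m 2%:E ->
  \int[m]_x ((\sum_(i <- s) h i x) * k x) = \sum_(i <- s) \int[m]_x (h i x * k x).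
Proof.
move=> + lk; elim: s => [_|i s IH hs].
  rewrite big_nil; under eq_Rintegral do rewrite big_nil mul0r.
  by rewrite /Rintegral integral0.
have hs' j : j \in s -> h j \in Lfun m 2%:E.
  by move=> js; apply: hs; rewrite inE js orbT.
rewrite big_cons -IH//; under eq_Rintegral do rewrite big_cons.
rewrite Rintegral_mulDl//; last exact: Lfun2_sum.
by apply: hs; rewrite mem_head.
Qed.

Lemma indic_itv_Lfun2 (R : realType) (a b : R) :
  \1_(`]a, b]%classic : set R) \in @Lfun _ (measurableTypeR R) R mu 2%:E.
Proof.
apply: Lfun2P; first exact: measurable_indic.
have sq (A : set R) x : (\1_A x : R) ^+ 2 = \1_A x.
  by rewrite indicE; case: (_ \in _); rewrite ?expr1n ?expr0n.
under eq_integral do rewrite sq.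
by rewrite integral_indic//= setIT lebesgue_measure_itv/=; case: ifP; rewrite // ltry.
Qed.

(** The minima match the covariance of an increment of W with W_c; for c below an interval both
    minima equal c and its term vanishes. *)
Lemma Rintegral_step_fun (R : realType) (s : seq (R * (R * R))) (c : R) :
  step_valid s -> 0 <= c ->
  \int[mu]_x (step_fun s x * \1_(`]0, c]%classic : set R) x) =
  \sum_(p <- s) p.1 * (Num.min p.2.2 c - Num.min p.2.1 c).
Proof.
move=> /allP vs c0.
rewrite Rintegral_mul_suml; [|by move=> p _; apply: Lfun2Z; exact: indic_itv_Lfun2|exact: indic_itv_Lfun2].
apply: eq_big_seq => p ps; have /andP[a0 ab] := vs p ps.
rewrite Rintegral_mulZl ?indic_itv_Lfun2//; congr (_ * _).
rewrite (_ : (fun x => _) = \1_(`]p.2.1, Num.min p.2.2 c]%classic : set R)); last first.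
  apply/funext => x; rewrite -[LHS]/((\1_(`]p.2.1, p.2.2]%classic : set R) \*
    \1_(`]0, c]%classic : set R)) x) -indicI; congr (\1_ _ x); apply/seteqP; split => y/=.
    by rewrite !in_itv/= le_min => -[/andP[-> ->] /andP[_ ->]].
  by rewrite !in_itv/= le_min => /andP[ay /andP[-> ->]]; rewrite ay (le_lt_trans a0).
rewrite /Rintegral integral_indic//= setIT lebesgue_measure_itv/= lte_fin.
case: ltP => [h|h] /=.
  have ac : p.2.1 <= c by rewrite (le_trans (ltW h))// ge_min lexx orbT.
  by rewrite (min_l ac).
suff -> : Num.min p.2.2 c = Num.min p.2.1 c by rewrite subrr.
apply/le_anti; rewrite !le_min !ge_min ?lexx ?orbT/= ab/= ?orbT ?andbT.
move: h; rewrite ge_min => /orP[->//|h].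
by rewrite h orbT.
Qed.

(** Lets the L^2 distance over the half-line be read over the whole line, with f extended by 0. *)
Lemma step_fun_lt0 (R : realType) (s : seq (R * (R * R))) (x : R) :
  step_valid s -> x < 0 -> step_fun s x = 0.
Proof.
move=> /allP vs x0; rewrite /step_fun big_seq big1// => p ps.
have /andP[a0 _] := vs p ps.
rewrite indicE memNset ?mulr0//= in_itv/= => /andP[ax _].
by have := lt_trans ax x0; rewrite ltNge a0.
Qed.

Lemma step_fun_Lfun2 (R : realType) (s : seq (R * (R * R))) :
  step_fun s \in @Lfun _ (measurableTypeR R) R mu 2%:E.
Proof. by apply: Lfun2_sum => p _; apply: Lfun2Z; exact: indic_itv_Lfun2. Qed.

Lemma cvg_Rintegral_step_fun (R : realType) (f : R -> R) (s : nat -> seq (R * (R * R))) (c : R) :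
  measurable_fun (`[0, +oo[%classic : set R) f ->
  mu.-integrable (`[0, +oo[%classic : set R) (fun x => (f x ^+ 2)%:E) ->
  (forall n, step_valid (s n)) ->
  (\int[mu]_(x in (`[0%R, +oo[%classic : set R))
    ((f x - step_fun (s n) x) ^+ 2)%:E)%E @[n --> \oo] --> 0%E ->
  \int[mu]_x (step_fun (s n) x * \1_(`]0, c]%classic : set R) x) @[n --> \oo] -->
  \int[mu]_x ((f \_ (`[0, +oo[%classic : set R)) x * \1_(`]0, c]%classic : set R) x).
Proof.
move=> mf if2 vs cvg_s; set D : set R := `[0, +oo[%classic in mf if2 cvg_s *.
have mD : measurable D by exact: measurable_itv.
have E (h : R -> R) : (\int[mu]_(x in D) (h x ^+ 2)%:E = \int[mu]_x (((h \_ D) x) ^+ 2)%:E)%E.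
  rewrite integral_mkcond; apply: eq_integral => x _; rewrite /patch.
  by case: ifP => // _; rewrite expr0n.
have lf : f \_ D \in @Lfun _ (measurableTypeR R) R mu 2%:E.
  apply: Lfun2P; first exact: ((measurable_restrictT f mD).1 mf).
  by rewrite -E; have /integrableP[_] := if2; under eq_integral do rewrite gee0_abs ?lee_fin ?sqr_ge0//.
apply: cvg_Rintegral_mul => //; first exact: indic_itv_Lfun2.
  by move=> n; exact: step_fun_Lfun2.
move: cvg_s; under eq_fun do rewrite E.
rewrite (_ : (fun n => _) = (fun n => \int[mu]_x (((f \_ D) x - step_fun (s n) x) ^+ 2)%:E)%E)//.
apply/funext => n; apply: eq_integral => x _; rewrite /patch.
case: ifPn => // /negP xD; rewrite step_fun_lt0 ?subrr//.
by rewrite ltNge; apply/negP => x0; apply: xD; rewrite inE /D/= in_itv/= x0.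
Qed.

Section wiener_integral_averaged.
Context d (T : measurableType d) (R : realType) (P : probability T R).
Variables (W : R -> {RV P >-> R}) (V : T * R -> R) (v : R) (f g : R -> R).
Hypothesis v0 : 0 <= v.
Hypothesis lW : forall t : R, 0 <= t -> (W t : T -> R) \in Lfun P 2%:E.
Hypothesis cW : forall s t : R, 0 <= s -> 0 <= t ->
  \int[P]_w (W s w * W t w) = v * Num.min s t.
Hypothesis mV : measurable_fun setT V.
Hypothesis VW : forall a, 0 < a -> {ae P, forall w, V (w, a) = W a w}.
Hypothesis mg : measurable_fun setT g.
Hypothesis g0 : forall x, x <= 0 -> g x = 0.
Hypothesis ig : mu.-integrable setT (fun x => (g x * Num.sqrt x)%:E).
Hypothesis igV2 : forall w,
  mu.-integrable setT (fun x => (g x * (V (w, x) ^+ 2 / Num.sqrt x))%:E).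
Hypothesis fg : forall c, 0 <= c ->
  \int[mu]_x ((f \_ (`[0, +oo[%classic : set R)) x * \1_(`]0, c]%classic : set R) x) =
  \int[mu]_x (g x * Num.min x c).

Let mVa a : measurable_fun setT (fun w => V (w, a)).
Proof. exact: measurableT_comp. Qed.

Let lV a : 0 < a -> (fun w => V (w, a)) \in Lfun P 2%:E.
Proof.
move=> a0; apply: Lfun2P => //.
rewrite (_ : (\int[P]_w _ = \int[P]_w (W a w ^+ 2)%:E)%E).
  have /integrableP[_] := Lfun2_integrable_sqr (lW (ltW a0)).
  by under eq_integral do rewrite gee0_abs ?lee_fin ?sqr_ge0//.
apply: ae_eq_integral => //.
- by apply/measurable_EFinP; exact: measurable_funX.
- by apply/measurable_EFinP; exact: measurable_funX.
- by have := VW a0; apply: filterS => w /= -> _.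
Qed.

Let Rintegral_VW a (Q : T -> R) : 0 < a -> measurable_fun setT Q ->
  \int[P]_w (V (w, a) * Q w) = \int[P]_w (W a w * Q w).
Proof.
move=> a0 mQ; rewrite /Rintegral; congr fine; apply: ae_eq_integral => //.
- by apply/measurable_EFinP; exact: measurable_funM.
- by apply/measurable_EFinP; exact: measurable_funM.
- by have := VW a0; apply: filterS => w /= -> _.
Qed.

Let cV a b : 0 < a -> 0 < b ->
  \int[P]_w (V (w, a) * V (w, b)) = v * Num.min a b.
Proof.
move=> a0 b0; rewrite Rintegral_VW//; under eq_Rintegral do rewrite mulrC.
rewrite Rintegral_VW//; under eq_Rintegral do rewrite mulrC.
by rewrite cW// ltW.
Qed.

Let step_wiener_Lfun2 (s : seq (R * (R * R))) : step_valid s ->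
  step_wiener W s \in Lfun P 2%:E.
Proof.
move=> /allP vs; apply: Lfun2_sum => p ps; have /andP[a0 ab] := vs p ps.
by apply: Lfun2Z; apply: Lfun2B; apply: lW => //; exact: le_trans ab.
Qed.

(** The Wiener isometry, up to the factor v, tested against W_c, the integral of the indicator of
    ]0, c]. *)
Let Rintegral_step_wiener (s : seq (R * (R * R))) (c : R) : step_valid s -> 0 <= c ->
  \int[P]_w (step_wiener W s w * W c w) =
  v * \int[mu]_x (step_fun s x * \1_(`]0, c]%classic : set R) x).
Proof.
move=> vs c0; rewrite Rintegral_step_fun//; move/allP : vs => vs.
have lp p : p \in s -> (fun w => W p.2.2 w - W p.2.1 w) \in Lfun P 2%:E.
  by move=> ps; have /andP[a0 ab] := vs p ps; apply: Lfun2B; apply: lW => //; exact: le_trans ab.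
rewrite Rintegral_mul_suml ?lW//; last by move=> p ps; exact/Lfun2Z/lp.
rewrite mulr_sumr; apply: eq_big_seq => p ps; have /andP[a0 ab] := vs p ps.
have b0 := le_trans a0 ab.
by rewrite Rintegral_mulZl ?lW ?lp// Rintegral_mulBl ?lW// !cW//; ring.
Qed.

Let Z := averaged V g.
Let lZ : Z \in Lfun P 2%:E := averaged_Lfun2 mV v0 lV cV mg g0 ig igV2.

(** Y and Z have the same covariance with each W_c: for Y it is the limit of those of the step
    integrals, for Z it comes from Fubini, and [fg] equates the two. *)
Lemma wiener_integral_averaged (Y : {RV P >-> R}) : is_wiener_integral W f Y ->
  {ae P, forall w, Y w = averaged V g w}.
Proof.
move=> [mf if2 [s [vs cs cY]]].
have lSW n := step_wiener_Lfun2 (vs n).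
have lY : (Y : T -> R) \in Lfun P 2%:E.
  (* Square integrability of Y is inherited from one step integral at finite L^2 distance. *)
  have [n hn] : exists n, ('E_P[(fun w => (Y w - step_wiener W (s n) w) ^+ 2)%R] < 1)%E.
    have [N _ hN] := cY _ (open_ereal_lt' (@lte01 R)).
    by exists N; apply: hN => /=.
  have lYS : (fun w => Y w - step_wiener W (s n) w) \in Lfun P 2%:E.
    apply: Lfun2P; first by apply: measurable_funB => //; exact: Lfun_measurable (lSW n).
    by rewrite unlock in hn; apply: lt_trans hn _; exact: ltry.
  have := Lfun2D lYS (lSW n); under eq_fun do rewrite subrK; by [].
have cY' (Q : T -> R) : Q \in Lfun P 2%:E ->
    \int[P]_w (step_wiener W (s n) w * Q w) @[n --> \oo] --> \int[P]_w (Y w * Q w).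
  move=> lQ; apply: cvg_Rintegral_mul => //.
  have E n : ('E_P[(fun w => (Y w - step_wiener W (s n) w) ^+ 2)%R] =
      \int[P]_w ((Y w - step_wiener W (s n) w) ^+ 2)%:E)%E by rewrite unlock.
  by move: cY; rewrite (eq_cvg _ _ E).
have YW c : 0 <= c -> \int[P]_w (Y w * W c w) =
    v * \int[mu]_x ((f \_ (`[0, +oo[%classic : set R)) x * \1_(`]0, c]%classic : set R) x).
  move=> c0; have h1 := cY' _ (lW c0).
  move: h1; rewrite (eq_cvg _ _ (fun n => Rintegral_step_wiener (vs n) c0)) => h1.
  have h2 := cvgM (cvg_cst v) (cvg_Rintegral_step_fun (c := c) mf if2 vs cs).
  rewrite -(cvg_lim _ h1)//; apply/cvg_lim => //; exact: h2.
have ZW c : 0 <= c -> \int[P]_w (Z w * W c w) = v * \int[mu]_x (g x * Num.min x c).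
  move=> c0; rewrite (Rintegral_averaged_mul mV v0 lV cV mg g0 ig igV2 (lW c0)).
  (* A minimum is at most the geometric mean: min(x, c) <= sqrt c sqrt x. *)
  have igm : mu.-integrable setT (fun x => (g x * Num.min x c)%:E).
    apply: le_integrable (integrableZl measurableT (Num.sqrt c) ig) => //.
      by apply/measurable_EFinP; apply: measurable_funM => //; apply: measurable_minr.
    move=> x _; rewrite -EFinM lee_fin mulrCA !normrM.
    have [x0|x0] := leP x 0; first by rewrite g0// normr0 !mul0r.
    rewrite ler_wpM2l// -normrM -sqrtrM// (ger0_norm (sqrtr_ge0 _)).
    rewrite ger0_norm ?le_min ?(ltW x0)// -[leLHS]ger0_norm ?le_min ?(ltW x0)// -sqrtr_sqr ler_wsqrtr//.
    have m0 : 0 <= Num.min x c by rewrite le_min (ltW x0).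
    by rewrite mulrC expr2 ler_pM// ge_min lexx ?orbT.
  rewrite -RintegralZl//; apply: eq_Rintegral => x _.
  have [x0|x0] := leP x 0; first by rewrite g0// !mul0r mulr0.
  by rewrite Rintegral_VW// cW ?(ltW x0)// mulrCA.
(* D is orthogonal to all W c, hence to Y (a limit of step integrals) and to Z. *)
pose D w := Y w - Z w.
have lD : D \in Lfun P 2%:E by exact: Lfun2B.
have mD := Lfun_measurable lD.
have DW c : 0 <= c -> \int[P]_w (W c w * D w) = 0.
  move=> c0; under eq_Rintegral do rewrite mulrC.
  by rewrite Rintegral_mulBl ?lW// YW// ZW// fg// subrr.
have DSW n : \int[P]_w (step_wiener W (s n) w * D w) = 0.
  have /allP vsn := vs n.
  rewrite Rintegral_mul_suml//; last first.
    move=> p ps; have /andP[a0 ab] := vsn p ps.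
    by apply: Lfun2Z; apply: Lfun2B; apply: lW => //; exact: le_trans ab.
  rewrite big_seq big1// => p ps; have /andP[a0 ab] := vsn p ps.
  have b0 := le_trans a0 ab.
  rewrite Rintegral_mulZl ?Lfun2B ?lW// Rintegral_mulBl ?lW// !DW//.
  by rewrite subrr mulr0.
have YD : \int[P]_w (Y w * D w) = 0.
  have := cY' _ lD; rewrite (eq_cvg _ _ DSW) => h.
  exact: (cvg_unique _ h (cvg_cst 0)).
have ZD : \int[P]_w (Z w * D w) = 0.
  rewrite (Rintegral_averaged_mul mV v0 lV cV mg g0 ig igV2 lD).
  rewrite /Rintegral integral0_eq// => x _.
  have [x0|x0] := leP x 0; first by rewrite g0// mul0r.
  rewrite -[X in _ * X]/(\int[P]_w (V (w, x) * D w)) Rintegral_VW//.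
  by rewrite DW ?(ltW x0)// mulr0.
have DD : \int[P]_w (D w * D w) = 0 by rewrite Rintegral_mulBl// YD ZD subrr.
by have := ae_eq_Rintegral_sqr_eq0 lD DD; apply: filterS => w /= /eqP; rewrite subr_eq0 => /eqP.
Qed.

End wiener_integral_averaged.

(** * A jointly measurable modification of Brownian motion *)

Lemma measurable_fun_nat_index d1 d2 d3 (T1 : measurableType d1) (T2 : measurableType d2)
    (T3 : measurableType d3) (phi : nat -> T1 -> T3) (k : T2 -> nat) :
  (forall i, measurable_fun setT (phi i)) -> (forall i, measurable (k @^-1` [set i])) ->
  measurable_fun setT (fun z : T1 * T2 => phi (k z.2) z.1).
Proof.
move=> mphi mk _ B mB; rewrite setTI.
rewrite (_ : _ @^-1` B = \bigcup_i ((fst @^-1` (phi i @^-1` B)) `&` (snd @^-1` (k @^-1` [set i])))).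
  apply: bigcup_measurable => i _; apply: measurableI.
    rewrite -[X in measurable X]setTI; apply: measurable_fst => //.
    by rewrite -[X in measurable X]setTI; exact: mphi.
  by rewrite -[X in measurable X]setTI; exact: measurable_snd.
by apply/seteqP; split => z /=; [move=> Bz; exists (k z.2)|move=> [i _ [/= Bz ->]]].
Qed.

Lemma measurable_truncn_fiber (R : realType) (c : R) (i : nat) : 0 <= c ->
  measurable [set x : R | Num.truncn (c * x) = i].
Proof.
move=> c0; have mt : measurable_fun setT (fun x : R => (Num.truncn (c * x))%:R : R).
  apply: nondecreasing_measurable => // x y xy.
  by rewrite ler_nat le_truncn// ler_wpM2l.
have := mt measurableT _ (measurable_set1 (i%:R : R)); rewrite setTI.
congr measurable; apply/seteqP; split => x /=; last by move=> ->.
by move=> /eqP; rewrite eqr_nat => /eqP.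
Qed.

Lemma cvg_truncn_div (R : realType) (x : R) : 0 <= x ->
  (Num.truncn (n.+1%:R * x))%:R / n.+1%:R @[n --> \oo] --> x.
Proof.
move=> x0.
apply: (@squeeze_cvgr _ _ _ _ (fun n => x - n.+1%:R^-1) (cst x)).
- near=> n; have n0 : 0 < n.+1%:R :> R by [].
  have nx : 0 <= n.+1%:R * x by rewrite mulr_ge0.
  have /andP[h1 h2] := truncn_itv nx.
  rewrite ler_pdivrMr// (mulrC x) h1 andbT ler_pdivlMr// mulrBl mulVf ?gt_eqF//.
  by rewrite lerBlDr natr1 mulrC ltW.
- rewrite -[X in _ --> X]subr0; apply: cvgB; [exact: cvg_cst|exact: cvg_harmonic].
- exact: cvg_cst.
Unshelve. all: by end_near. Qed.

(** Off a null set, path continuity makes W_x the limit of W at the grid points floor((n+1) x) /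
    (n+1). Each approximation takes countably many time values, hence is jointly measurable. The
    factor [k] sets V to 0 on the null set and for x <= 0. *)
Lemma brownian_jointly_measurable d (T : measurableType d) (R : realType)
    (P : probability T R) (W : R -> {RV P >-> R}) : standard_brownian_motion W ->
  exists V : T * R -> R, measurable_fun setT V /\
    {ae P, forall w, forall x, 0 < x -> V (w, x) = W x w}.
Proof.
move=> hW; have [N [mN PN0 subN]] := brownian_continuous_paths hW.
pose k (z : T * R) : R := \1_(~` N) z.1 * \1_(`]0, +oo[%classic : set R) z.2.
have mk : measurable_fun setT k.
  apply: measurable_funM.
    by apply: measurableT_comp => //; apply: measurable_indic; exact: measurableC.
  apply: measurableT_comp => //; exact: measurable_indic.
exists (fun z => k z * W z.2 z.1); split.
  apply: (@measurable_fun_cvg _ _ _ _ (fun n z => k z *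
    W ((Num.truncn (n.+1%:R * z.2))%:R / n.+1%:R) z.1)) => [n|[w x] _ /=].
    apply: measurable_funM => //.
    apply: (measurable_fun_nat_index (phi := fun i => W (i%:R / n.+1%:R))
      (k := fun x : R => Num.truncn (n.+1%:R * x))) => // i.
    exact: measurable_truncn_fiber.
  have [wN|wN] := pselect (N w).
    rewrite /k/= (@indicE _ R (~` N)) memNset// !mul0r.
    by under eq_fun do rewrite !mul0r; exact: cvg_cst.
  have [x0|x0] := leP x 0.
    rewrite /k/= (@indicE _ R `]0, +oo[%classic) memNset ?mulr0 ?mul0r/=; last first.
      by rewrite in_itv/= andbT; apply/negP; rewrite -leNgt.
    by under eq_fun do rewrite mul0r; exact: cvg_cst.
  apply: cvgM; first exact: cvg_cst.
  have : {within `[0, +oo[, continuous (fun t : R => W t w)}.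
    by apply: contrapT => /subN.
  move=> /continuous_within_itvcyP[cW _].
  have cx : {for x, continuous (fun t : R => W t w)} by apply: cW; rewrite in_itv/= x0.
  exact: (cvg_comp _ _ (cvg_truncn_div (ltW x0)) cx).
exists N; split => // w /= h; apply: contrapT => wN; apply: h => x x0.
by rewrite /k/= !indicE !mem_set/= ?in_itv/= ?x0// !mul1r.
Qed.

Section integrable_modification.
Context d (T : measurableType d) (R : realType) (P : probability T R).
Variables (V : T * R -> R) (v : R) (g : R -> R).
Hypothesis mV : measurable_fun setT V.
Hypothesis v0 : 0 <= v.
Hypothesis V2 : forall x, 0 < x -> (\int[P]_w (V (w, x) ^+ 2)%:E = (v * x)%:E)%E.
Hypothesis mg : measurable_fun setT g.
Hypothesis g0 : forall x, x <= 0 -> g x = 0.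
Hypothesis ig : mu.-integrable setT (fun x => (g x * Num.sqrt x)%:E).

(** The expected integral of |g(x)| V_x^2 / sqrt x is at most v \int |g(x)| sqrt x dx, which is
    finite. *)
Lemma ae_integrable_weighted_sqr : {ae P, forall w,
  mu.-integrable setT (fun x => (g x * (V (w, x) ^+ 2 / Num.sqrt x))%:E)}.
Proof.
pose F (z : T * measurableTypeR R) := (g z.2 * (V z ^+ 2 / Num.sqrt z.2))%:E.
have mF : measurable_fun setT F.
  apply/measurable_EFinP; apply: measurable_funM.
    exact: (measurableT_comp mg (@measurable_snd _ _ T (measurableTypeR R))).
  apply: measurable_funM; first exact: measurable_funX.
  exact: (measurableT_comp (@measurable_invr_sqrt R)
    (@measurable_snd _ _ T (measurableTypeR R))).
suff iF : (P \x mu)%E.-integrable setT F by exact: ae_integrable1 iF.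
have mFa : measurable_fun setT (abse \o F) by exact: measurableT_comp.
apply/(integrable21ltyP P (mu : {sigma_finite_measure set (measurableTypeR R) -> \bar R}) mF).
apply: (@le_lt_trans _ _ (\int[mu]_x (v%:E * `|g x * Num.sqrt x|%:E))%E); last first.
  rewrite integralZl//; last exact: integrable_norm ig.
  by apply: lte_mul_pinfty => //; have /integrableP[_] := ig.
apply: ge0_le_integral => //.
- by move=> x _; exact: integral_ge0.
- refine (@measurable_fun_fubini_tonelli_G _ _ T (measurableTypeR R) R P (abse \o F) mFa _).
  by move=> z; exact: abse_ge0.
- exact: (measurable_int mu (integrableZl measurableT _ (integrable_norm ig))).
move=> x _; have [x0|x0] := leP x 0.
  under eq_integral do rewrite /F/= g0// !mul0r normr0.
  by rewrite integral0 g0// mul0r normr0 mule0.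
have s0 : 0 < Num.sqrt x by rewrite sqrtr_gt0.
have mVx : measurable_fun setT (fun w => V (w, x)) by exact: measurableT_comp.
rewrite (_ : (\int[P]_w _ = \int[P]_w ((`|g x| / Num.sqrt x)%:E * (V (w, x) ^+ 2)%:E))%E).
  rewrite ge0_integralZl_EFin ?divr_ge0 ?(ltW s0)//; first last.
  - by apply/measurable_EFinP; exact: measurable_funX.
  - by move=> w _; rewrite lee_fin sqr_ge0.
  rewrite V2// -!EFinM lee_fin normrM (ger0_norm (ltW s0)) le_eqVlt; apply/orP; left.
  by apply/eqP; rewrite -[X in v * X](sqr_sqrtr (ltW x0)); field; rewrite gt_eqF.
apply: eq_integral => w _; rewrite /F/= -EFinM (normrM (g x)).
by rewrite (@ger0_norm _ (_ / _)) ?divr_ge0 ?sqr_ge0 ?(ltW s0)// [in LHS]mulrA [in LHS]mulrAC.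
Qed.

End integrable_modification.

(** V is set to 0 on the exceptional null set, so that integrability holds for every w and every
    trajectory of the version is regular. *)
Lemma brownian_modification d (T : measurableType d) (R : realType)
    (P : probability T R) (W : R -> {RV P >-> R}) (v : R) (g : R -> R) :
  standard_brownian_motion W -> 0 <= v ->
  (forall t : R, 0 <= t -> (W t : T -> R) \in Lfun P 2%:E) ->
  (forall s t : R, 0 <= s -> 0 <= t -> \int[P]_w (W s w * W t w) = v * Num.min s t) ->
  measurable_fun setT g -> (forall x, x <= 0 -> g x = 0) ->
  mu.-integrable setT (fun x => (g x * Num.sqrt x)%:E) ->
  exists V : T * R -> R, [/\ measurable_fun setT V,
    forall x, 0 < x -> {ae P, forall w, V (w, x) = W x w} &
    forall w, mu.-integrable setT (fun x => (g x * (V (w, x) ^+ 2 / Num.sqrt x))%:E)].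
Proof.
move=> hW v0 lW cW mg g0 ig.
have [V0 [mV0 V0W]] := brownian_jointly_measurable hW.
have V02 x : 0 < x -> (\int[P]_w (V0 (w, x) ^+ 2)%:E = (v * x)%:E)%E.
  move=> x0; transitivity (\int[P]_w (W x w ^+ 2)%:E)%E.
    apply: ae_eq_integral => //.
    - by apply/measurable_EFinP; apply: measurable_funX; exact: measurableT_comp.
    - by apply/measurable_EFinP; exact: measurable_funX.
    - by move: V0W; apply: filterS => w /= h _; rewrite h.
  rewrite -[LHS]fineK ?fin_num_integral_sqr ?lW ?(ltW x0)//.
  by rewrite -[in RHS](minxx x) -cW ?(ltW x0).
have [N [mN PN0 subN]] := ae_integrable_weighted_sqr mV0 v0 V02 mg g0 ig.
exists (fun z => \1_(~` N) z.1 * V0 z); split.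
- apply: measurable_funM => //.
  by apply: measurableT_comp => //; apply: measurable_indic; exact: measurableC.
- move=> x x0; have nN : {ae P, forall w, ~ N w}.
    by exists N; split => // w /= /contrapT.
  move: V0W nN; apply: filterS2 => w /= h wN.
  by rewrite indicE mem_set// mul1r h.
move=> w; have [wN|wN] := pselect (N w).
  under eq_fun do rewrite /= indicE memNset// mul0r expr0n/= mul0r mulr0.
  exact: integrable0.
under eq_fun do rewrite /= indicE mem_set// mul1r.
by apply: contrapT => /subN.
Qed.

(** * Power kernels *)

Lemma is_derive_powR_div (R : realType) (r x : R) : r + 1 != 0 -> 0 < x ->
  is_derive x 1 (fun y => y `^ (r + 1) / (r + 1)) (x `^ r).
Proof.
move=> r1 x0; have d := is_derive1_powR (r + 1) x0.
rewrite (_ : (fun y => _) = (r + 1)^-1 \*: (@powR R ^~ (r + 1))); last first.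
  by apply/funext => y; rewrite mulrC.
by apply: is_derive_eq; rewrite /GRing.scale/= addrK mulrA mulVf// mul1r.
Qed.

Lemma continuous_powR (R : realType) (r x : R) : 0 < x -> {for x, continuous (fun y : R => y `^ r)}.
Proof.
move=> x0; apply/differentiable_continuous/derivable1_diffP.
by have [] := is_derive1_powR r x0.
Qed.

Lemma integral_powR_itv (R : realType) (r p q : R) : r + 1 != 0 -> 0 < p -> p < q ->
  (\int[mu]_(x in `[p, q]) (x `^ r)%:E =
    (q `^ (r + 1) / (r + 1))%:E - (p `^ (r + 1) / (r + 1))%:E)%E.
Proof.
move=> r1 p0 pq; have q0 := lt_trans p0 pq.
have cF x : 0 < x -> {for x, continuous (fun y : R => y `^ (r + 1) / (r + 1))}.
  move=> x0; apply/differentiable_continuous/derivable1_diffP.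
  by have [] := is_derive_powR_div r1 x0.
apply: (@continuous_FTC2 _ _ (fun x => x `^ (r + 1) / (r + 1))) => //.
- apply: continuous_in_subspaceT => x; rewrite inE/= in_itv/= => /andP[px _].
  exact: continuous_powR (lt_le_trans p0 px).
- split.
  + move=> x; rewrite in_itv/= => /andP[px _].
    by have [] := is_derive_powR_div r1 (lt_trans p0 px).
  + by apply: cvg_at_right_filter; exact: cF.
  + by apply: cvg_at_left_filter; exact: cF.
- move=> x; rewrite in_itv/= => /andP[px _].
  by rewrite derive1E; have [_ ->] := is_derive_powR_div r1 (lt_trans p0 px).
Qed.

Lemma integral_powR_oc01_lty (R : realType) (r : R) : -1 < r ->
  (\int[mu]_(x in `]0%R, 1%R]) (x `^ r)%:E < +oo)%E.
Proof.
move=> r1; have r0 : 0 < r + 1 by lra.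
have -> : `]0, 1 : R]%classic = \bigcup_n `[n.+1%:R^-1, 1]%classic.
  apply/seteqP; split => x /=.
    rewrite in_itv/= => /andP[x0 x1]; have [n _ hn] := near_infty_natSinv_lt (PosNum x0).
    exists n => //=; rewrite in_itv/= x1 andbT ltW//.
    by apply: hn => /=.
  by move=> [n _]; rewrite /= !in_itv/= => /andP[nx ->]; rewrite andbT (lt_le_trans _ nx)// invr_gt0.
have cvgI := @ge0_nondecreasing_set_cvg_integral _ (measurableTypeR R) R
  (fun n => `[n.+1%:R^-1, 1]%classic) (fun x => (x `^ r)%:E) mu.
have {}cvgI : (\int[mu]_(x in `[n.+1%:R^-1%R, 1%R]) (x `^ r)%:E)%E @[n --> \oo] -->
    (\int[mu]_(x in \bigcup_n `[n.+1%:R^-1%R, 1%R]%classic) (x `^ r)%:E)%E.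
  apply: cvgI.
  - move=> m n mn; apply/subsetPset => x /=; rewrite !in_itv/= => /andP[h ->]; rewrite andbT.
    by rewrite (le_trans _ h)// lef_pV2 ?posrE// ler_nat.
  - by move=> n; exact: measurable_itv.
  - by move=> n; apply/measurable_EFinP/measurable_funTS; exact: measurable_powR.
  - by move=> n x _; rewrite lee_fin powR_ge0.
rewrite -(cvg_lim _ cvgI)//; apply: (@le_lt_trans _ _ ((r + 1)^-1%:E)); last exact: ltry.
apply: lime_le; first by apply/cvg_ex; eexists; exact: cvgI.
(* For n = 0 the interval is the single point 1, which the fundamental theorem on p < q does not
   cover. *)
apply: nearW => n; have [->|n0] := eqVneq n 0%N.
  by rewrite invr1 set_itv1 integral_set1 lee_fin invr_ge0 ltW.
rewrite integral_powR_itv ?gt_eqF ?invr_gt0//; last first.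
  by rewrite invf_lt1// ltr1n ltnS lt0n.
by rewrite powR1 mul1r -EFinB lee_fin gerBl// divr_ge0 ?powR_ge0// ltW.
Qed.

Lemma cvg_powRy0 (R : realType) (r : R) : r < 0 -> x `^ r @[x --> +oo] --> 0.
Proof.
move=> r0; apply/cvgrPdist_lt => e e0; near=> x.
have x0 : 0 < x by near: x; exact: nbhs_pinfty_gt.
rewrite sub0r normrN ger0_norm ?powR_ge0// -(@lnK _ e) ?posrE// /powR gt_eqF// ltr_expR.
rewrite -ltr_ndivrMl// -[X in X < _]expRK; near: x.
exists (expR (r^-1 * ln e)); split; first exact: num_real.
move=> x hx; rewrite ltr_ln ?posrE ?expR_gt0//.
exact: lt_trans (expR_gt0 _) hx.
Unshelve. all: by end_near. Qed.

(** The integrand of X_t is [damped_power a 0 - damped_power a t]. *)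
Definition damped_power (R : realType) (a t x : R) : R := x `^ (- a) * expR (- (x * t)).

(** Minus the derivative in x. Unlike x^(-a-1) kappa(x t), which changes sign for 0 < a < 1 and t >
    0, it is nonnegative, so the fundamental theorem on [x, +oo[ for nonnegative integrands
    applies. *)
Definition damped_power_slope (R : realType) (a t x : R) : R :=
  (t * x `^ (- a) + a * x `^ (- a - 1)) * expR (- (x * t)).

Lemma is_derive_damped_power (R : realType) (a t x : R) : 0 < x ->
  is_derive x 1 (damped_power a t) (- damped_power_slope a t x).
Proof.
move=> x0; have d := is_derive1_powR (- a) x0.
rewrite /damped_power (_ : (fun y => _) = (@powR R ^~ (- a)) * (fun y => expR (- (y * t))))//.
by apply: is_derive_eq; rewrite /damped_power_slope /GRing.scale/=; ring.
Qed.

Lemma damped_power_slope_ge0 (R : realType) (a t x : R) : 0 <= a -> 0 <= t ->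
  0 <= damped_power_slope a t x.
Proof.
move=> a0 t0; rewrite mulr_ge0 ?expR_ge0// addr_ge0//.
  by rewrite mulr_ge0 ?powR_ge0.
by rewrite mulr_ge0 ?powR_ge0.
Qed.

Lemma continuous_damped_power_slope (R : realType) (a t x : R) : 0 < x ->
  {for x, continuous (damped_power_slope a t)}.
Proof.
move=> x0; apply: cvgM.
  apply: cvgD; (apply: cvgM; [exact: cvg_cst|exact: continuous_powR]).
apply: continuous_comp; last exact: continuous_expR.
by apply: cvgN; apply: cvgM; [exact: cvg_id|exact: cvg_cst].
Qed.

Lemma integral_damped_power_slope (R : realType) (a t x : R) : 0 < a -> 0 <= t -> 0 < x ->
  (\int[mu]_(y in `[x, +oo[) (damped_power_slope a t y)%:E = (damped_power a t x)%:E)%E.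
Proof.
move=> a0 t0 x0.
have cF y : 0 < y -> {for y, continuous (fun y => - damped_power a t y)}.
  move=> y0; apply: cvgN; apply/differentiable_continuous/derivable1_diffP.
  by have [] := is_derive_damped_power a t y0.
have dF (y : R) : 0 < y -> is_derive y 1 (fun y => - damped_power a t y) (damped_power_slope a t y).
  move=> y0; have d := is_derive_damped_power a t y0.
  by apply: is_derive_eq; rewrite opprK.
rewrite (@ge0_continuous_FTC2y _ _ (fun y => - damped_power a t y) x 0).
- by rewrite -EFinB opprK add0r.
- by move=> y _; apply: damped_power_slope_ge0 => //; exact: ltW.
- apply: continuous_in_subspaceT => y; rewrite inE/= in_itv/= andbT => xy.
  exact: continuous_damped_power_slope (lt_le_trans x0 xy).
- rewrite -[0 in X in _ --> X]oppr0; apply: cvgN.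
  have a0' : - a < 0 by rewrite oppr_lt0.
  apply: (@squeeze_cvgr _ _ _ _ (cst 0) (fun y => y `^ (- a))).
  + near=> y; have y0 : 0 < y by near: y; exact: nbhs_pinfty_gt.
    rewrite /cst /damped_power mulr_ge0 ?powR_ge0 ?expR_ge0//=.
    by rewrite ler_piMr ?powR_ge0// -[leRHS]expR0 ler_expR oppr_le0 mulr_ge0// ltW.
  + exact: cvg_cst.
  + exact: cvg_powRy0.
- by move=> y xy; have [] := dF _ (lt_trans x0 xy).
- by apply: cvg_at_right_filter; exact: cF.
- move=> y; rewrite in_itv/= andbT => xy.
  by rewrite derive1E; have [_ ->] := dF _ (lt_trans x0 xy).
Unshelve. all: by end_near. Qed.

(** The undamped case t = 0, with a = - r - 1: the slope is then a y^r. *)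
Lemma integral_powR_cy_lty (R : realType) (r : R) : r < -1 ->
  (\int[mu]_(x in `[1%R, +oo[) (x `^ r)%:E < +oo)%E.
Proof.
move=> r1; have a0 : 0 < - r - 1 by lra.
have := integral_damped_power_slope a0 (lexx 0) ltr01.
rewrite (_ : (fun y => _) = (fun y => (- r - 1)%:E * (y `^ r)%:E)%E); last first.
  apply/funext => y; rewrite /damped_power_slope mul0r add0r mulr0 oppr0 expR0 mulr1.
  by rewrite -EFinM; congr (_ * _ `^ _)%:E; lra.
rewrite ge0_integralZl_EFin ?(ltW a0)//; first last.
- by apply/measurable_EFinP/measurable_funTS; exact: measurable_powR.
- by move=> x _; rewrite lee_fin powR_ge0.
move=> E; rewrite -(@lte_pmul2l _ (- r - 1)%:E) ?lte_fin// E gt0_muley ?lte_fin//.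
exact: ltry.
Qed.

(** The cutoff makes every kernel built on it vanish for x <= 0, as the hypotheses [g0] and [H0]
    ask. *)
Definition power_weight (R : realType) (a x : R) : R := if 0 < x then x `^ (- a - 1) else 0.

Lemma measurable_power_weight (R : realType) (a : R) : measurable_fun setT (power_weight a).
Proof.
by apply: measurable_fun_ifT => //; first exact: measurable_fun_ltr.
Qed.

Lemma power_weight_le0 (R : realType) (a x : R) : x <= 0 -> power_weight a x = 0.
Proof. by rewrite /power_weight ltNge => ->. Qed.

(** The exponent is 1/2 - a > -1 near 0, and - a - 1/2 < -1 at infinity because a > 1/2. *)
Lemma integrable_power_weight (R : realType) (a : R) : 2^-1 < a -> a < 1 ->
  mu.-integrable setT (fun x : R => (power_weight a x * Num.min 1 x * Num.sqrt x)%:E).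
Proof.
move=> a2 a1.
have i1 : mu.-integrable setT ((EFin \o (fun x : R => x `^ (2^-1 - a))) \_ `]0, 1]%classic).
  apply/(integrable_mkcond _ _).1 => //; apply/integrableP; split.
    by apply/measurable_EFinP/measurable_funTS; exact: measurable_powR.
  under eq_integral do rewrite gee0_abs ?lee_fin ?powR_ge0//.
  by apply: integral_powR_oc01_lty; lra.
have i2 : mu.-integrable setT ((EFin \o (fun x : R => x `^ (- a - 2^-1))) \_ `[1, +oo[%classic).
  apply/(integrable_mkcond _ _).1 => //; apply/integrableP; split.
    by apply/measurable_EFinP/measurable_funTS; exact: measurable_powR.
  under eq_integral do rewrite gee0_abs ?lee_fin ?powR_ge0//.
  by apply: integral_powR_cy_lty; lra.
have m_sqrt : measurable_fun setT (@Num.sqrt R).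
  exact: continuous_measurable_fun (@sqrt_continuous R).
apply: le_integrable (integrableD measurableT i1 i2) => //.
  apply/measurable_EFinP; apply: measurable_funM => //; apply: measurable_funM.
    exact: measurable_power_weight.
  exact: measurable_minr.
move=> x _; have [x0|x0] := leP x 0.
  by rewrite power_weight_le0// !mul0r abse0 abse_ge0.
rewrite /power_weight x0 -(powR12_sqrt (ltW x0)) /= /patch/=.
have pD (r s : R) : x `^ (r + s) = x `^ r * x `^ s by rewrite powRD// (gt_eqF x0) implybT.
have p0 (r : R) := powR_ge0 x r.
have [x1|] := boolP (x <= 1); last rewrite -ltNge => x1.
  rewrite (min_r x1) ger0_norm ?mulr_ge0// ?(ltW x0)// mem_set/= ?in_itv/= ?x0//.
  have -> : x `^ (- a - 1) * x * x `^ 2^-1 = x `^ (2^-1 - a).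
    by rewrite -[X in _ * X * _](powRr1 (ltW x0)) -!pD; congr (_ `^ _); lra.
  case: ifP => _; rewrite ?adde0 -?EFinD /abse lee_fin ?ger0_norm ?addr_ge0//.
  by rewrite lerDl.
rewrite (min_l (ltW x1)) mulr1 -pD ger0_norm// ifF; last first.
  by apply/negbTE/negP; rewrite inE/= in_itv/= x0/= leNgt x1.
rewrite add0e mem_set/=; last by rewrite in_itv/= andbT ltW.
by rewrite (_ : - a - 1 + 2^-1 = - a - 2^-1) ?ger0_norm//; lra.
Qed.

(** * Integration by parts in weak form *)

Section tail_integral.
Context {R : realType}.
Variables (f g : R -> R).
Hypothesis mg : measurable_fun setT g.
Hypothesis g0 : forall x, x <= 0 -> g x = 0.
Hypothesis ig : mu.-integrable setT (fun x => (g x * Num.sqrt x)%:E).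
Hypothesis fE : forall x, 0 < x -> \int[mu]_(y in `[x, +oo[) g y = f x.

Let integral_tail_fin_num (x : R) : 0 < x -> (\int[mu]_(y in `[x, +oo[) (g y)%:E)%E \is a fin_num.
Proof.
move=> x0; pose T1 := measurableTypeR R.
have mD : measurable (`[x, +oo[%classic : set T1) by exact: measurable_itv.
have ig1 := integrableS measurableT mD (@subsetT _ _) ig.
have s0 : 0 < Num.sqrt x by rewrite sqrtr_gt0.
apply: (integrable_fin_num mD).
apply: le_integrable (integrableZl mD (Num.sqrt x)^-1 ig1).
- exact: mD.
- by apply/measurable_EFinP/measurable_funTS.
move=> y /=; rewrite in_itv/= andbT => xy; rewrite lee_fin mulrCA normrM.
apply: ler_peMr; first exact: normr_ge0.
have h : 1 <= (Num.sqrt x)^-1 * Num.sqrt y.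
  by rewrite mulrC ler_pdivlMr// mul1r ler_wsqrtr.
exact: le_trans h (ler_norm _).
Qed.

(** Fubini on the region 0 < x <= c, x <= y: the section at y has length min(y, c), at most sqrt c
    sqrt y, which gives absolute convergence. *)
Lemma Rintegral_tail (c : R) : 0 <= c ->
  \int[mu]_x ((f \_ (`[0, +oo[%classic : set R)) x * \1_(`]0, c]%classic : set R) x) =
  \int[mu]_x (g x * Num.min x c).
Proof.
move=> c0; pose T1 := measurableTypeR R.
pose h (z : T1 * T1) : R := \1_(`]0, c]%classic : set R) z.1 * (if z.1 <= z.2 then 1 else 0).
pose F (z : T1 * T1) := (g z.2 * h z)%:E.
have m1 : measurable_fun setT (fun z : T1 * T1 => z.1 : R) by exact: measurable_fst.
have m2 : measurable_fun setT (fun z : T1 * T1 => z.2 : R) by exact: measurable_snd.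
have mh : measurable_fun setT h.
  apply: measurable_funM.
    by apply: (measurableT_comp _ m1); exact: measurable_indic.
  by apply: measurable_fun_ifT => //; exact: measurable_fun_ler.
have mF : measurable_fun setT F.
  by apply/measurable_EFinP; apply: measurable_funM => //; exact: (measurableT_comp mg m2).
have mFa : measurable_fun setT (abse \o F) by exact: measurableT_comp.
have mhx (x : T1) : measurable_fun setT (fun y : T1 => h (y, x)) by exact: measurableT_comp.
have h0 z : 0 <= h z by rewrite /h mulr_ge0//; case: ifP.
have hE (x : R) : 0 < x -> (\int[mu]_y (h (y, x))%:E = (Num.min x c)%:E)%E.
  move=> x0; have m0 : 0 <= Num.min x c by rewrite le_min (ltW x0).
  transitivity (\int[mu]_y (\1_(`]0%R, Num.min x c]%classic : set R) y)%:E)%E.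
    apply: eq_integral => y _; congr EFin; rewrite /h/= !indicE.
    case: ifPn => yx; rewrite ?mulr1 ?mulr0.
      congr (nat_of_bool _)%:R; apply/idP/idP; rewrite !inE/= !in_itv/= le_min.
        by move=> /andP[-> ->]; rewrite yx.
      by move=> /and3P[-> _ ->].
    rewrite memNset//= in_itv/= le_min => /and3P[_ h1 _].
    by move: yx; rewrite h1.
  rewrite integral_indic//= setIT lebesgue_measure_itv/= lte_fin.
  case: ltP => [_|m1']; first by rewrite -EFinB subr0.
  by congr EFin; apply/le_anti; rewrite m0 m1'.
have iF : (mu \x mu)%E.-integrable setT F.
  apply/(integrable21ltyP (mu : {sigma_finite_measure set T1 -> \bar R})
    (mu : {sigma_finite_measure set T1 -> \bar R}) mF).
  apply: (@le_lt_trans _ _ (\int[mu]_x ((Num.sqrt c)%:E * `|g x * Num.sqrt x|%:E))%E); last first.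
    rewrite integralZl//; last exact: integrable_norm ig.
    by apply: lte_mul_pinfty => //; have /integrableP[_] := ig.
  apply: ge0_le_integral => //.
  - by move=> x _; exact: integral_ge0.
  - refine (@measurable_fun_fubini_tonelli_G _ _ T1 T1 R mu (abse \o F) mFa _).
    by move=> z; exact: abse_ge0.
  - exact: (measurable_int mu (integrableZl measurableT _ (integrable_norm ig))).
  move=> x _; have [x0|x0] := leP x 0.
    under eq_integral do rewrite /F/= g0// mul0r normr0.
    by rewrite integral0 g0// mul0r normr0 mule0.
  under eq_integral do rewrite /F/= normrM (ger0_norm (h0 _)) EFinM.
  rewrite ge0_integralZl_EFin//; first last.
  - by apply/measurable_EFinP; exact: mhx.
  - by move=> y _; rewrite lee_fin.
  rewrite hE// -!EFinM lee_fin normrM mulrCA ler_wpM2l// ger0_norm ?sqrtr_ge0//.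
  have m0 : 0 <= Num.min x c by rewrite le_min (ltW x0).
  rewrite -sqrtrM// -[leLHS]ger0_norm// -sqrtr_sqr ler_wsqrtr//.
  by rewrite mulrC expr2 ler_pM// ge_min lexx ?orbT.
have E1 : (\int[mu]_x \int[mu]_y (g y * h (x, y))%:E =
    \int[mu]_x ((f \_ (`[0%R, +oo[%classic : set R)) x * \1_(`]0%R, c]%classic : set R) x)%:E)%E.
  apply: eq_integral => x _; rewrite /h/= indicE.
  have [|xc] := boolP (x \in (`]0, c]%classic : set R)); last first.
    by under eq_integral do rewrite mul0r mulr0; rewrite integral0 mulr0.
  rewrite inE/= in_itv/= => /andP[x0 xc].
  rewrite mulr1 /patch mem_set/=; last by rewrite in_itv/= andbT ltW.
  rewrite -(fE x0).
  rewrite fineK; last exact: integral_tail_fin_num x0.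
  rewrite [RHS]integral_mkcond; apply: eq_integral => y _.
  rewrite patchE; have [xy|xy] := boolP (x <= y).
    by rewrite mem_set ?mulr1//= in_itv/= xy.
  by rewrite memNset ?mulr0//= in_itv/= (negbTE xy).
have E2 : (\int[mu]_y \int[mu]_x (g y * h (x, y))%:E = \int[mu]_y (g y * Num.min y c)%:E)%E.
  apply: eq_integral => y _; have [y0|y0] := leP y 0.
    by under eq_integral do rewrite g0// mul0r; rewrite integral0 g0// mul0r.
  under eq_integral do rewrite EFinM.
  rewrite integralZl ?hE//.
  apply/integrableP; split.
    by apply/measurable_EFinP; exact: mhx.
  by under eq_integral do rewrite gee0_abs ?lee_fin//; rewrite hE// ltry.
have := Fubini iF; rewrite /F/= => FE.
by rewrite /Rintegral -E1 FE E2.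
Qed.

End tail_integral.

Lemma power_weight_potential_kernelE (R : realType) (a t x : R) : 0 < x ->
  power_weight a x * potential_kernel a (x * t) =
  damped_power_slope a 0 x - damped_power_slope a t x.
Proof.
move=> x0; rewrite /power_weight x0 /potential_kernel /damped_power_slope.
rewrite mul0r add0r mulr0 oppr0 expR0.
have -> : x `^ (- a) = x * x `^ (- a - 1).
  by rewrite -{2}(powRr1 (ltW x0)) -powRD ?(gt_eqF x0) ?implybT//; congr (_ `^ _); lra.
ring.
Qed.

Lemma Rintegral_power_weight_potential_kernel (R : realType) (a t x : R) :
  0 < a -> 0 <= t -> 0 < x ->
  \int[mu]_(y in `[x, +oo[) (power_weight a y * potential_kernel a (y * t)) =
  (1 - expR (- (x * t))) * x `^ (- a).
Proof.
move=> a0 t0 x0.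
have i (s : R) : 0 <= s ->
    mu.-integrable (`[x, +oo[%classic : set R) (fun y => (damped_power_slope a s y)%:E).
  move=> s0; apply/integrableP; split.
    apply/measurable_EFinP/measurable_funTS; apply: measurable_funM.
      by apply: measurable_funD; apply: measurable_funM => //; exact: measurable_powR.
    apply: measurableT_comp => //; apply: measurableT_comp => //; exact: measurable_funM.
  under eq_integral do rewrite gee0_abs ?lee_fin ?damped_power_slope_ge0 ?(ltW a0)//.
  by rewrite integral_damped_power_slope// ltry.
transitivity (\int[mu]_(y in `[x, +oo[) (damped_power_slope a 0 y - damped_power_slope a t y)).
  apply: eq_Rintegral => y; rewrite inE/= in_itv/= andbT => xy.
  by rewrite power_weight_potential_kernelE// (lt_le_trans x0).
rewrite RintegralB ?i//.
rewrite /Rintegral !integral_damped_power_slope//= /damped_power mulr0 oppr0 expR0; ring.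
Qed.

(** * The smooth version *)

Lemma ae_eq_probability1 d (T : measurableType d) (R : realType) (P : probability T R)
    (f g : {RV P >-> R}) : {ae P, forall w, f w = g w} -> P [set w | f w = g w] = 1%E.
Proof.
move=> [N [mN PN0 subN]].
have mE : measurable [set w | f w = g w].
  rewrite (_ : [set w | f w = g w] = (f \- g) @^-1` [set 0]).
    rewrite -[X in measurable X]setTI.
    exact: (measurable_funB (measurable_funPT f) (measurable_funPT g)).
  apply/seteqP; split => w /=; first by move=> ->; rewrite subrr.
  by move=> /eqP; rewrite subr_eq0 => /eqP.
apply/eqP; rewrite eq_le probability_le1//=.
rewrite -(probability_setT P) -(setUv [set w | f w = g w]).
apply: le_trans (measureU2 _ mE (measurableC mE)) _.
rewrite -[leRHS]adde0 leeD2l// -PN0 le_measure ?inE//; exact: measurableC.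
Qed.

(** Transfers integrability from the t-free weight to the kernel of X_t; it serves for h = sqrt x
    and for h = V_x^2 / sqrt x. *)
Lemma le_integrable_power_weight (R : realType) (a t : R) (h : R -> R) :
  0 <= a -> 0 <= t -> measurable_fun setT h ->
  mu.-integrable setT (fun x => (power_weight a x * Num.min 1 x * h x)%:E) ->
  mu.-integrable setT (fun x => (power_weight a x * potential_kernel a (x * t) * h x)%:E).
Proof.
move=> a0 t0 mh ih.
apply: le_integrable (integrableZl measurableT ((a + 1) * (1 + t)) ih) => //.
  apply/measurable_EFinP; apply: measurable_funM => //; apply: measurable_funM.
    exact: measurable_power_weight.
  exact: measurable_potential_kernel.
move=> x _; rewrite -EFinM lee_fin; have [x0|x0] := leP x 0.
  by rewrite power_weight_le0// !mul0r mulr0.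
rewrite mulrA (mulrCA _ (power_weight a x)) !normrM ler_wpM2r// ler_wpM2l//.
by rewrite (le_trans (potential_kernel_le a0 t0 x0))// -!normrM ler_norm.
Qed.

Theorem theorem1 (R : realType) (K : R) (hK0 : 0 < K) (hK1 : K < 1)
    (d : measure_display) (T : measurableType d) (P : probability T R)
    (W : R -> {RV P >-> R}) (hW : standard_brownian_motion W)
    (X : R -> {RV P >-> R})
    (hX : forall t : R, 0 <= t ->
      is_wiener_integral W
        (fun theta => (1 - expR (- (theta * t))) * theta `^ (- ((1 + K) / 2)))
        (X t)) :
  exists X' : R -> {RV P >-> R},
    is_version X X' /\
    forall w : T,
      smooth_on_pos (fun t => X' t w) /\
      absolutely_continuous_half_line (fun t => X' t w).
Proof.
pose a : R := (1 + K) / 2; rewrite -/a in hX.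
have a_gt : 2^-1 < a by rewrite /a; lra.
have a_lt1 : a < 1 by rewrite /a; lra.
have a_gt0 : 0 < a by lra.
have [v [v0 lW cW]] := brownian_covariance hW.
pose g0 x := power_weight a x * Num.min 1 x.
pose g t x := power_weight a x * potential_kernel a (x * t).
have mw := measurable_power_weight a.
have mg0 : measurable_fun setT g0.
  by apply: measurable_funM => //; exact: measurable_minr.
have mg t : measurable_fun setT (g t).
  by apply: measurable_funM => //; exact: measurable_potential_kernel.
have g0_le0 x : x <= 0 -> g0 x = 0 by move=> x0; rewrite /g0 power_weight_le0// mul0r.
have g_le0 t x : x <= 0 -> g t x = 0 by move=> x0; rewrite /g power_weight_le0// mul0r.
have m_sqrt : measurable_fun setT (@Num.sqrt R).
  exact: continuous_measurable_fun (@sqrt_continuous R).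
have ig0 := integrable_power_weight a_gt a_lt1.
have ig t : 0 <= t -> mu.-integrable setT (fun x => (g t x * Num.sqrt x)%:E).
  by move=> t0; apply: le_integrable_power_weight => //; exact: ltW.
(* V is adapted to [g0], which up to constants dominates every [g t] with t >= 0. One modification
   thus serves all times at once. *)
have [V [mV VW igV0]] := brownian_modification hW v0 lW cW mg0 g0_le0 ig0.
have mVw w : measurable_fun setT (fun x => V (w, x)) by exact: measurableT_comp.
have igV t w : 0 <= t ->
    mu.-integrable setT (fun x => (g t x * (V (w, x) ^+ 2 / Num.sqrt x))%:E).
  move=> t0; apply: le_integrable_power_weight => //; first exact: ltW.
  apply: measurable_funM; first exact: measurable_funX.
  exact: measurable_invr_sqrt.
pose X' t : {RV P >-> R} := mfun_Sub (mem_set (measurable_averaged mV (mg t))).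
have X'E t w : X' t w = averaged V (g t) w by [].
exists X'; split.
  move=> t t0; apply: ae_eq_probability1.
  have fg := Rintegral_tail (mg t) (@g_le0 t) (ig t t0)
    (fun x x0 => Rintegral_power_weight_potential_kernel a_gt0 t0 x0).
  have := wiener_integral_averaged v0 lW cW mV VW (mg t) (@g_le0 t) (ig t t0)
    (fun w => igV t w t0) fg (hX t t0).
  by apply: filterS => w /= ->.
(* With w fixed, the rest is deterministic: the whole path is the potential of H. *)
move=> w; pose H x := power_weight a x * V (w, x).
have mH : measurable_fun setT H by exact: measurable_funM.
have H0 x : x <= 0 -> H x = 0 by move=> x0; rewrite /H power_weight_le0// mul0r.
have iH : mu.-integrable setT (fun x => (H x * Num.min 1 x)%:E).
  have := integrable_averaged mV mg0 g0_le0 ig0 igV0 w.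
  by apply: eq_integrable => // x _; rewrite /H /g0 mulrAC.
have pathE : (fun t => X' t w) = potential H a.
  by apply/funext => t; rewrite X'E; apply: eq_Rintegral => x _; rewrite /g /H mulrAC.
rewrite pathE; split; first exact: potential_smooth mH H0 iH a.
exact: (potential_absolutely_continuous mH H0 iH (ltW a_gt0)).
Qed.
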